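(* Let $(d_n)$ be a sequence of positive integers satisfying $\lim_{n\to\infty} d_n=\infty$ and $d_n-1=n^{\varepsilon_n}$ for some sequence $\varepsilon_n=o(1)$. Let $A_n$ be the adjacency matrix of the random $d_n$-regular graph $G_n=G(n,d_n)$. Then, as $n\to\infty$, the empirical spectral distribution of the matrix $(d_n-1)^{-1/2}A_n$ converges in distribution (as a random probability measure on $\mathbb{R}$ with the topology of weak convergence; since the limit is deterministic, this is the same as convergence in probability) to the semicircle law on $[-2,2]$, i.e. the probability measure with density $$f_{\mathrm{sc}}(x)=\frac{1}{2\pi}\sqrt{4-x^2},\qquad -2<x<2.$$
   Context: $G(n,d)$ denotes a graph chosen uniformly at random from the set of all labeled simple graphs with vertex set $\{1,\dots,n\}$ in which every vertex has degree $d$ (it is implicit that $d<n$ and $nd$ is even, so that such graphs exist). The adjacency matrix is the symmetric $0/1$ matrix whose $(i,j)$ entry is $1$ iff $i$ and $j$ are joined by an edge. The empirical spectral distribution (ESD) of a real symmetric $n\times n$ matrix with eigenvalues $\lambda_1,\dots,\lambda_n$ (with multiplicity) is the probability measure $\frac1n\sum_{i=1}^n\delta_{\lambda_i}$. *)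

(* Defs.v *)
From HB Require Import structures.
From mathcomp Require Import all_boot all_order all_algebra.
From mathcomp Require Import complex.
From mathcomp Require Import all_classical all_reals all_analysis.
From mathcomp Require Import measurable_realfun.
From mathcomp Require Import ring lra.

Set Implicit Arguments.
Unset Strict Implicit.
Unset Printing Implicit Defensive.

Import Order.TTheory GRing.Theory Num.Theory numFieldNormedType.Exports.

Local Open Scope ring_scope.

(* A graph on the vertex set 'I_n is given by its set of edges, each edge being
   a set of two vertices; in particular [set i; i], of cardinality 1, is never
   an edge. *)
Section graphs.
Local Open Scope set_scope.
Variable n : nat.
Implicit Types E : {set {set 'I_n}}.

Definition is_simple_graph E : bool := [forall e in E, #|e| == 2].

Definition degree E (i : 'I_n) : nat := #|[set j | [set i; j] \in E]|.

Definition regular_graphs (d : nat) : {set {set {set 'I_n}}} :=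
  [set E | is_simple_graph E && [forall i, degree E i == d]].

Definition adjacency (R : realType) E : 'M[R]_n :=
  \matrix_(i, j) ([set i; j] \in E)%:R.

Lemma adjacency_sym (R : realType) E : (adjacency R E)^T = adjacency R E.
Proof. by apply/matrixP => i j; rewrite !mxE finset.setUC. Qed.

End graphs.

Lemma sym_char_poly_split (R : rcfType) n (A : 'M[R]_n) : A^T = A ->
  exists s : n.-tuple R, char_poly A = \prod_(a <- s) ('X - a%:P).
Proof.
move=> symA; set f : {rmorphism R -> R[i]} := real_complex R.
pose B := map_mx f A.
have Breal : B \is a mxOver Num.real.
  by apply/mxOverP => i j; rewrite mxE; apply/complex_realP; exists (A i j).
have Bherm : B \is hermsymmx.
  apply: realsym_hermsym => //.
  by apply/is_hermitianmxP; rewrite expr0 scale1r map_mx_id// /B map_trmx symA.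
have /mxOverP spR := hermitian_spectral_diag_real Bherm.
have /orthomx_spectralP := hermitian_normalmx Bherm.
set P := spectralmx B; set sp := spectral_diag B => eB.
have Pu : P \in unitmx := spectral_unit B.
have cB : char_poly B = \prod_(i < n) ('X - (sp 0 i)%:P).
  have -> : char_poly B = char_poly (diag_mx sp).
    rewrite eB /char_poly /char_poly_mx.
    transitivity (\det (map_mx polyC (invmx P) *m ('X%:M - map_mx polyC (diag_mx sp)) *m map_mx polyC P)).
      congr (\det _); rewrite mulmxBr mulmxBl !map_mxM; congr (_ - _).
      by rewrite -mulmxA -[X in _ *m X]scalar_mxC mulmxA -map_mxM mulVmx// map_mx1 mul1mx.
    rewrite !det_mulmx mulrC mulrA -det_mulmx -map_mxM mulmxV// map_mx1 det1.
    by rewrite mul1r.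
  rewrite char_poly_trig ?diag_mx_is_trig//.
  by apply: eq_bigr => i _; rewrite mxE eqxx mulr1n.
exists [tuple complex.Re (sp 0 i) | i < n].
apply: (@map_poly_inj _ _ f).
rewrite map_char_poly -/B cB rmorph_prod/= big_map big_enum/=.
by apply: eq_bigr => i _; rewrite rmorphB/= map_polyX map_polyC/= RRe_real.
Qed.

Local Open Scope classical_set_scope.

(* The eigenvalues of A, with algebraic multiplicity. The zero tuple is returned
   when the characteristic polynomial does not split over R, which never happens
   for a symmetric matrix. *)
Definition eigenvalues (R : realType) n (A : 'M[R]_n) : n.-tuple R :=
  xget [tuple 0 | _ < n]
    [set s : n.-tuple R | char_poly A = \prod_(a <- s) ('X - a%:P)].

Lemma char_poly_eigenvalues (R : realType) n (A : 'M[R]_n) : A^T = A ->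
  char_poly A = \prod_(a <- eigenvalues A) ('X - a%:P).
Proof.
move=> /sym_char_poly_split splitA.
rewrite /eigenvalues; case: xgetP => [s _ ->//|noA].
by case: splitA => s /noA.
Qed.

Section weak_topology.
Variable R : realType.

Definition bounded_continuous :=
  {f : R -> R | continuous f /\ [bounded f x | x in setT]}.

Definition borel_probability : Type := probability (measurableTypeR R) R.

HB.instance Definition _ := Choice.on borel_probability.

Definition integral_of (f : bounded_continuous) (mu : borel_probability) : R :=
  \int[(mu : probability (measurableTypeR R) R)]_x sval f x.

(* The topology of weak convergence: the coarsest one making all the maps
   integral_of f continuous (see cvg_weakP). *)
HB.instance Definition _ := Topological.copy borel_probability
  (sup_topology (fun f : bounded_continuous =>
    Topological.class (initial_topology (integral_of f)))).

Lemma cvg_weakP (F : set_system borel_probability) (mu : borel_probability) :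
  Filter F ->
  F --> mu <-> forall f, integral_of f nu @[nu --> F] --> integral_of f mu.
Proof.
move=> FF; split=> [/cvg_sup cF f|cF].
  apply: cvg_trans (@initial_continuous _ _ (integral_of f) mu).
  by apply: cvg_app; exact: cF.
apply/cvg_sup => f U [V [[B oB <-] Bmu BU]].
apply: filterS BU _; apply: (cF f); exact: open_nbhs_nbhs.
Qed.

End weak_topology.

(* The normalized counting measure on the eigenvalues, i.e. the average of the
   Dirac masses at the eigenvalues; the second argument of mnormalize is a
   default value used only for n = 0 (see esdE). *)
Definition esd (R : realType) n (A : 'M[R]_n) : borel_probability R :=
  mnormalize
    (msum (fun i => \d_((eigenvalues A)`_i : measurableTypeR R)) n)
    \d_(0 : measurableTypeR R).

Lemma esdE (R : realType) n (A : 'M[R]_n) (B : set (measurableTypeR R)) :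
  (0 < n)%N ->
  (esd A : probability (measurableTypeR R) R) B =
  ((n%:R^-1)%:E * \sum_(i < n) \d_(tnth (eigenvalues A) i : measurableTypeR R) B)%E.
Proof.
move=> n0; rewrite /esd /= /mnormalize /=.
have -> : msum (fun i => \d_((eigenvalues A)`_i : measurableTypeR R)) n setT = n%:R%:E :> \bar R.
  rewrite /msum (eq_bigr (fun=> 1%E)); last by move=> i _; exact: diracT.
  by rewrite sumEFin big_const_ord iter_addr_0.
rewrite eqe pnatr_eq0 gtn_eqF//= muleC; congr (_ * _)%E.
by rewrite /msum; apply: eq_bigr => i _; rewrite (tnth_nth 0).
Qed.

Section semicircle.
Context {R : realType}.
Notation mu := (@lebesgue_measure R).

Definition semicircle_pdf (x : R) : R :=
  if (-2 < x < 2) then (2 * pi)^-1 * Num.sqrt (4 - x ^+ 2) else 0.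

Let g (x : R) : R := (2 * pi)^-1 * Num.sqrt (4 - x ^+ 2).

Let gE : semicircle_pdf = g.
Proof.
apply/funext => x; rewrite /semicircle_pdf /g; case: ifPn => // /negP xlt.
rewrite ler0_sqrtr ?mulr0//; rewrite leNgt; apply/negP => h; apply: xlt.
by apply/andP; split; nra.
Qed.

Lemma semicircle_pdf_ge0 x : 0 <= semicircle_pdf x.
Proof. by rewrite gE mulr_ge0 ?sqrtr_ge0// invr_ge0 mulr_ge0// pi_ge0. Qed.

Let cg : continuous g.
Proof.
move=> x; apply: cvgM; first exact: cvg_cst.
apply: (@continuous_comp _ _ _ (fun x : R => 4 - x ^+ 2) (@Num.sqrt R)); last exact: sqrt_continuous.
by apply: cvgB; [exact: cvg_cst|exact: exprn_continuous].
Qed.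

Lemma measurable_semicircle_pdf : measurable_fun setT semicircle_pdf.
Proof. by rewrite gE; exact: continuous_measurable_fun. Qed.

Let F (t : R) : R := 2 * sin t.
Let G (t : R) : R := pi^-1 * (t + sin t * cos t).
Let dF (t : R) : is_derive t (1 : R) F (2 * cos t).
Proof. by rewrite /F; apply: is_derive_eq; rewrite /GRing.scale/=; ring. Qed.
Let dG (t : R) : is_derive t (1 : R) G (2 / pi * cos t ^+ 2).
Proof.
apply: is_derive_eq; rewrite /GRing.scale/= -[X in X + _](cos2Dsin2 t); ring.
Qed.
Let F'E : derive1 F = fun t => 2 * cos t.
Proof. by apply/funext => t; rewrite derive1E; apply: derive_val. Qed.
Let G'E : derive1 G = fun t => 2 / pi * cos t ^+ 2.
Proof. by apply/funext => t; rewrite derive1E; apply: derive_val. Qed.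
Let cder (H : R -> R) (h : R -> R) : (forall t : R, is_derive t (1:R) H (h t)) -> continuous H.
Proof. by move=> dH t; apply/differentiable_continuous/derivable1_diffP; case: (dH t). Qed.
Let cF : continuous F := cder dF.
Let cG : continuous G := cder dG.
Let cF' : continuous (fun t : R => 2 * cos t).
Proof. by move=> t; apply: cvgM; [exact: cvg_cst|exact: continuous_cos]. Qed.
Let npi : - (pi / 2) < pi / 2 :> R.
Proof. by have := pi_gt0 R; lra. Qed.

Lemma integral_semicircle_pdf : (\int[mu]_x (semicircle_pdf x)%:E = 1)%E.
Proof.
have pi0 : pi != 0 :> R by rewrite gt_eqF// pi_gt0.
transitivity (\int[mu]_(x in `[(- 2 : R)%R, (2 : R)%R]) (g x)%:E)%E.
  rewrite [RHS]integral_mkcond; apply: eq_integral => x _.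
  rewrite gE patchE; case: ifPn => // /negP xn; rewrite /g ler0_sqrtr ?mulr0//.
  rewrite leNgt; apply/negP => h; apply: xn; rewrite inE/= in_itv/=.
  by apply/andP; split; nra.
have aux (p c : R) : p != 0 -> (2 * p)^-1 * (2 * c) * (2 * c) = 2 / p * c ^+ 2.
  by move=> p0; field.
have aux2 (p : R) : p != 0 ->
    p^-1 * (p / 2 + 1 * 0) - p^-1 * (- (p / 2) + - 1 * 0) = 1.
  by move=> p0; field.
have FN : F (- (pi / 2)) = -2 by rewrite /F sinN sin_pihalf mulrN1.
have Fp : F (pi / 2) = 2 by rewrite /F sin_pihalf mulr1.
rewrite -[X in `[X, _]]FN -[X in `[_, X]]Fp.
rewrite integration_by_substitution_increasing//; first last.
- exact: continuous_subspaceT.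
- split; last 2 first.
  + by apply: cvg_at_right_filter; exact: cF.
  + by apply: cvg_at_left_filter; exact: cF.
  + by move=> t _; case: (dF t).
- rewrite F'E; apply/cvg_ex; exists (2 * cos (pi / 2)).
  by apply: cvg_at_left_filter; exact: cF'.
- rewrite F'E; apply/cvg_ex; exists (2 * cos (- (pi / 2))).
  by apply: cvg_at_right_filter; exact: cF'.
- by rewrite F'E => t _; exact: cF'.
- by move=> x y xI yI xy; rewrite /F ltr_pM2l// ltr_sin.
- exact: ltW.
transitivity (\int[mu]_(x in `[(- (pi / 2) : R)%R, (pi / 2 : R)%R]) (2 / pi * cos x ^+ 2)%R%:E)%E.
  apply: eq_integral => t; rewrite inE/= in_itv/= => tI; congr EFin.
  rewrite F'E /g /F !fctE/=.
  have -> : 4 - (2 * sin t) ^+ 2 = (2 * cos t) ^+ 2.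
    by rewrite !exprMn sin2cos2; ring.
  rewrite sqrtr_sqr ger0_norm; last by rewrite mulr_ge0// cos_ge0_pihalf.
  by apply: aux.
rewrite (@continuous_FTC2 _ (fun x : R => 2 / pi * cos x ^+ 2) G)//.
- rewrite -EFinB; congr EFin; rewrite /G sinN cosN sin_pihalf cos_pihalf.
  exact: aux2.
- apply: continuous_subspaceT => t.
  apply: cvgM; first exact: cvg_cst.
  apply: (@continuous_comp _ _ _ cos (fun x : R => x ^+ 2)); first exact: continuous_cos.
  exact: exprn_continuous.
- split; last 2 first.
  + by apply: cvg_at_right_filter; exact: cG.
  + by apply: cvg_at_left_filter; exact: cG.
  + by move=> t _; case: (dG t).
- by move=> t _; rewrite G'E.
Qed.

Definition semicircle_law (V : set (measurableTypeR R)) : \bar R :=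
  (\int[mu]_(x in V) (semicircle_pdf x)%:E)%E.

Let semicircle0 : semicircle_law set0 = 0%E.
Proof. exact: integral_set0. Qed.

Let semicircle_ge0 V : (0 <= semicircle_law V)%E.
Proof. by apply: integral_ge0 => x _; rewrite lee_fin semicircle_pdf_ge0. Qed.

Let semicircle_sigma_additive : semi_sigma_additive semicircle_law.
Proof.
move=> /= A mA tA mUA; apply: cvg_toP.
  apply: ereal_nondecreasing_is_cvgn => m n mn.
  by apply: lee_sum_nneg_natr => // k _ _; exact: semicircle_ge0.
rewrite /semicircle_law ge0_integral_bigcup//=.
  apply/measurable_funTS/measurable_EFinP; exact: measurable_semicircle_pdf.
by move=> x _; rewrite lee_fin semicircle_pdf_ge0.
Qed.

HB.instance Definition _ := isMeasure.Build _ _ _ semicircle_law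
  semicircle0 semicircle_ge0 semicircle_sigma_additive.

HB.instance Definition _ := @Measure_isProbability.Build _ _ R
  semicircle_law integral_semicircle_pdf.

End semicircle.

(* The expectation of f at a uniformly random element of A, meaningful only for
   nonempty A (it is 0 for A empty). *)
Definition uniform_expectation (R : realType) (T : finType) (A : {set T})
    (f : T -> R) : R :=
  (\sum_(x in A) f x) / #|A|%:R.

(* Convergence in distribution, along the filter F, to the deterministic limit l
   of the random elements X i of S, where X i is evaluated at a uniformly random
   element of A i. *)
Definition cvg_in_distribution (R : realType) (S : topologicalType) (I : Type)
    (F : set_system I) (T : I -> finType) (A : forall i, {set T i})
    (X : forall i, T i -> S) (l : S) : Prop :=
  forall phi : S -> R, continuous phi -> [bounded phi x | x in setT] ->
    uniform_expectation (A i) (fun t => phi (X i t)) @[i --> F] --> phi l.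

(* Main.v *)
(** Let A be the adjacency matrix, a = d - 1, and let U_k be the Chebyshev
    polynomials of the second kind rescaled to [-2, 2]. The numbers of
    nonbacktracking walks of length k are the entries of
    a^(k/2) (U_k(A / sqrt a) - U_(k-2)(A / sqrt a) / a). Hence, by induction on
    k >= 1, the average of U_k over the rescaled spectrum tends to 0 in
    probability once the mean number of closed nonbacktracking walks of length k
    is o(n a^(k/2)). Such a walk contains a cycle, and the mean number of cycles
    of length l is at most 2 d^l: replacing the closing edge uv of the cycle and
    an edge xy far from it by ux and vy, in about n d ways, turns a pair (graph,
    cycle) into a pair (graph, path), and at most d^2 choices lead to the same
    result. The mean number of closed walks is thus O(d^k), and d^k = n^o(1).
    The U_k with k >= 1 integrate to 0 against the semicircle law and, with 1,
    span the polynomials, so that all moments converge; the even ones control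
    the tails and Weierstrass' theorem gives weak convergence. *)

Require Import Defs.
From mathcomp Require Import all_boot all_order all_algebra.
From mathcomp Require Import complex.
From mathcomp Require Import all_classical all_reals all_analysis.
From mathcomp Require Import measurable_realfun.
From mathcomp Require Import zify ring lra.

Import Order.TTheory GRing.Theory Num.Theory numFieldNormedType.Exports.
Set Implicit Arguments.
Unset Strict Implicit.
Unset Printing Implicit Defensive.

(** * Nonbacktracking walks *)

Section walks.
Local Open Scope nat_scope.
Variables (V : finType) (e : rel V).
Implicit Types (k m d : nat) (b c v : V) (F G : seq V -> nat).

(** The argument of [F] omits the origin [b]. Recursion on the first step makes the recurrences
    below hold by unfolding; [walk_sumE] gives the form over tuples, needed to exchange the sum with
    one over graphs. *)
Fixpoint walk_sum k b F : nat :=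
  if k is k'.+1 then \sum_(c | e b c) walk_sum k' c (fun w => F (c :: w))
  else F [::].

Fixpoint nonbacktracking (s : seq V) : bool :=
  if s is a :: t then
    (if t is _ :: c :: _ then a != c else true) && nonbacktracking t
  else true.

Definition nbwalks k b v : nat :=
  walk_sum k b (fun w => nonbacktracking (b :: w) && (last b w == v)).

(** Cycles with a base point and an orientation: [m] counts the steps before the closing edge, so
    the cycle has length m + 1. It is a genuine cycle only for m >= 2. *)
Definition cyclic_walks m : nat :=
  \sum_c walk_sum m c (fun w => uniq (c :: w) && e (last c w) c).

Lemma leq_walk_sum k b F G :
  (forall w, size w = k -> path e b w -> F w <= G w) ->
  walk_sum k b F <= walk_sum k b G.
Proof.
elim: k b F G => [|k IH] b F G FG /=; first exact: FG.
apply: leq_sum => c bc; apply: IH => w sw pw.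
by apply: FG; rewrite /= ?sw// bc.
Qed.

Lemma eq_walk_sum k b F G : F =1 G -> walk_sum k b F = walk_sum k b G.
Proof.
by move=> FG; apply/eqP; rewrite eqn_leq !leq_walk_sum// => w _ _; rewrite FG.
Qed.

Lemma walk_sumD k b F G :
  walk_sum k b (fun w => F w + G w) = walk_sum k b F + walk_sum k b G.
Proof.
elim: k b F G => [|k IH] b F G //=.
by rewrite -big_split/=; apply: eq_bigr => c _; rewrite -IH.
Qed.

Lemma walk_sum0 k b : walk_sum k b (fun=> 0) = 0.
Proof. by elim: k b => [|k IH] b //=; rewrite big1. Qed.

Lemma walk_sum_sum k b (I : Type) (r : seq I) (P : pred I) (F : I -> seq V -> nat) :
  walk_sum k b (fun w => \sum_(i <- r | P i) F i w) =
  \sum_(i <- r | P i) walk_sum k b (F i).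
Proof.
elim: r => [|i r IH].
  by rewrite big_nil -[RHS](walk_sum0 k b); apply: eq_walk_sum => w; rewrite big_nil.
rewrite big_cons -IH -walk_sumD; case: ifPn => Pi.
  by apply: eq_walk_sum => w; rewrite big_cons Pi.
by apply: eq_walk_sum => w; rewrite big_cons (negPf Pi).
Qed.

Lemma walk_sumE k b F :
  walk_sum k b F = \sum_(w : k.-tuple V | path e b w) F w.
Proof.
elim: k b F => [|k IH] b F /=.
  rewrite (big_pred1 [tuple]) // => w; rewrite tuple0.
  by rewrite /= eqxx.
rewrite (reindex (fun p : V * k.-tuple V => cons_tuple p.1 p.2)) /=; last first.
  exists (fun w : k.+1.-tuple V => (thead w, behead_tuple w)) => [[c w] _|w _] /=.
    by rewrite theadE; congr (_, _); apply: val_inj.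
  by case/tupleP: w => c w; apply: val_inj; rewrite /= theadE.
rewrite -(pair_big_dep (fun c => e b c) (fun c (w : k.-tuple V) => path e c w)
  (fun c (w : k.-tuple V) => F (c :: w))) /=.
by apply: eq_bigr => c _; rewrite IH.
Qed.

Lemma sum_indicator (P : pred V) v : \sum_(c | P c) (c == v) = P v :> nat.
Proof.
case Pv: (P v); first by rewrite (bigD1 v)//= eqxx big1// => c /andP[_ /negPf->].
by rewrite big1// => c Pc; case: (c =P v) => // cv; rewrite cv Pv in Pc.
Qed.

Section regular.
Hypothesis esym : symmetric e.
Hypothesis eirr : irreflexive e.
Variable d : nat.
Hypothesis ereg : forall b, #|[pred c | e b c]| = d.

Lemma walk_sum1 k b : walk_sum k b (fun=> 1) = d ^ k.
Proof.
elim: k b => [|k IH] b //=.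
by rewrite (eq_bigr _ (fun c _ => IH c)) sum_nat_const ereg expnS.
Qed.

(** Each walk of length [l] has [d ^ (k - l)] extensions to length [k]. *)
Lemma walk_sum_take k l b F : l <= k ->
  walk_sum k b (fun w => F (take l w)) = d ^ (k - l) * walk_sum l b F.
Proof.
elim: l k b F => [|l IH] k b F lk.
  rewrite subn0 /= -(walk_sum1 k b) mulnC.
  under eq_walk_sum do rewrite take0.
  elim: k b {lk} => [|k IHk] b //=; first by rewrite muln1.
  by rewrite big_distrr/=; apply: eq_bigr => c _; exact: IHk.
case: k lk => // k lk /=; rewrite subSS big_distrr/=.
by apply: eq_bigr => c _; rewrite (IH k c (fun w => F (c :: w))).
Qed.

(** Continuations of a step from [a] to [b]: remembering the previous vertex makes the
    nonbacktracking condition local, hence the recursion [nbfromS]. *)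
Let nbfrom k a b v :=
  walk_sum k b (fun w => nonbacktracking [:: a, b & w] && (last b w == v)).

Let nbwalksS k b v : nbwalks k.+1 b v = \sum_(c | e b c) nbfrom k b c v.
Proof. by []. Qed.

Let nbfrom0 a b v : nbfrom 0 a b v = (b == v).
Proof. by []. Qed.

Let nbfromS k a b v :
  nbfrom k.+1 a b v = \sum_(c | e b c && (c != a)) nbfrom k b c v.
Proof.
rewrite /nbfrom /= big_mkcondr/=; apply: eq_bigr => c _; case: ifPn => ca.
  by apply: eq_walk_sum => w /=; rewrite eq_sym ca.
rewrite -[RHS](walk_sum0 k c); apply: eq_walk_sum => w /=.
by rewrite eq_sym (negPf ca).
Qed.

Lemma nbwalks0 b v : nbwalks 0 b v = (b == v).
Proof. by []. Qed.

Lemma nbwalks1 b v : nbwalks 1 b v = e b v.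
Proof.
by rewrite nbwalksS (eq_bigr (fun c => nat_of_bool (c == v)))// sum_indicator.
Qed.

Let sum_nbwalksS k b v :
  \sum_(c | e b c) nbwalks k.+1 c v =
  nbwalks k.+2 b v + \sum_(c | e b c) nbfrom k c b v.
Proof.
rewrite [nbwalks k.+2 b v]nbwalksS -big_split; apply: eq_bigr => c bc.
rewrite nbwalksS nbfromS (bigD1 b) ?(esym c)//= addnC; congr addn.
Qed.

(** A walk from a neighbour [c] of [b], preceded by [b], either is nonbacktracking or returns to [b]
    at once. In the second case a walk of length [k] from [b] remains, and [c] is any neighbour of
    [b] except its second vertex: d - 1 choices, or d if k = 0. *)
Lemma nbwalksSS k b v :
  \sum_(c | e b c) nbwalks k.+1 c v =
  nbwalks k.+2 b v + (if k == 0 then d else d.-1) * nbwalks k b v.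
Proof.
rewrite sum_nbwalksS; congr addn; case: k => [|k] /=.
  under eq_bigr do rewrite nbfrom0.
  by rewrite sum_nat_const ereg nbwalks0.
under eq_bigr do rewrite nbfromS.
rewrite nbwalksS (exchange_big_dep (e b)) /=; last by move=> c c' _ /andP[].
rewrite big_distrr/=; apply: eq_bigr => c bc.
rewrite (eq_bigl (fun c' => (c' != c) && e b c')); last first.
  by move=> c'; rewrite bc andbC eq_sym.
rewrite sum_nat_const; congr muln.
have := cardD1 c [pred c | e b c]; rewrite ereg inE bc /= => ->.
by apply: eq_card => c'; rewrite !inE.
Qed.

(** Closed walks are relaxed to walks with a repeated vertex: this property passes to the tail
    unless the only repetition is at the origin, which allows a recursion on the length. *)
Definition repeating_walks k : nat :=
  \sum_b walk_sum k b (fun w => nonbacktracking (b :: w) && ~~ uniq (b :: w)).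

Lemma trace_nbwalks_le k : \sum_b nbwalks k.+1 b b <= repeating_walks k.+1.
Proof.
apply: leq_sum => b _; apply: leq_walk_sum => w sw _.
case: (nonbacktracking _) => //=; case: eqP => // wb.
by rewrite -{1}wb; case: w sw wb => //= c w _ _; rewrite mem_last.
Qed.

Let sum_first (G : V -> nat) : \sum_b \sum_(c | e b c) G c = d * \sum_c G c.
Proof.
rewrite (exchange_big_dep predT)//= big_distrr/=; apply: eq_bigr => c _.
rewrite sum_nat_const -(ereg c); congr muln.
by apply: eq_card => b; rewrite !inE esym.
Qed.

(** The closing edge is traversed first: its end [b] is the last vertex of the path starting at
    [c]. *)
Lemma cyclic_walksE m :
  cyclic_walks m = \sum_b walk_sum m.+1 b (fun w => uniq w && (last b w == b)).
Proof.
rewrite /= (exchange_big_dep predT)//=; apply: eq_bigr => c _.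
rewrite -walk_sum_sum; apply: eq_walk_sum => w.
rewrite /=; case: (c \notin w); case: (uniq w) => /=; rewrite ?big1_eq//.
by under eq_bigr do rewrite eq_sym; rewrite (sum_indicator (e^~ c)).
Qed.

(* A repetition that is absent from the tail of the walk closes a cycle at its
   origin; it has length at least 3 since the walk does not backtrack. *)
Let first_repetition b w :
  path e b w -> nonbacktracking (b :: w) && ~~ uniq (b :: w) <=
  (nonbacktracking w && ~~ uniq w) +
  \sum_(l < size w | 2 <= l) (uniq (take l.+1 w) && (last b (take l.+1 w) == b)).
Proof.
move=> pw /=; case uw: (uniq w) => /=; last first.
  by rewrite andbF !andbT; apply: leq_trans (leq_addr _ _); case: w {pw uw} => //= c w; lia.
rewrite andbF add0n andbT; case bw: (b \in w); rewrite ?andbF//= andbT.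
rewrite -[X in nat_of_bool X <= _]/(nonbacktracking (b :: w)).
case nw: (nonbacktracking (b :: w)) => //.
have ltw : index b w < size w by rewrite index_mem.
have ge2 : 2 <= index b w.
  case: w pw uw bw nw {ltw} => //= c w /andP[bc]; rewrite inE.
  have bcF : (b == c) = false by apply: contraTF bc => /eqP ->; rewrite eirr.
  rewrite [c == b]eq_sym bcF; case: w => //= c' w _ _ _ /andP[/negPf bc' _].
  by rewrite eq_sym bc'.
rewrite (bigD1 (Ordinal ltw)) //= (take_nth b)// last_rcons nth_index// eqxx andbT.
have -> : rcons (take (index b w) w) b = take (index b w).+1 w.
  by rewrite (take_nth b)// nth_index.
by rewrite take_uniq.
Qed.

(** Sum of [first_repetition] over all walks: a repeating tail has [d] possible predecessors, and an
    initial cycle of l + 1 steps has [d ^ (k - l)] continuations. *)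
Lemma repeating_walksS k :
  repeating_walks k.+1 <= d * repeating_walks k +
    \sum_(l < k.+1 | 2 <= l) d ^ (k - l) * cyclic_walks l.
Proof.
rewrite [repeating_walks k]/repeating_walks -sum_first /repeating_walks.
under [X in _ <= _ + X]eq_bigr do rewrite cyclic_walksE big_distrr/=.
rewrite [X in _ <= _ + X]exchange_big/= -big_split/=; apply: leq_sum => b _.
set G := fun w => nonbacktracking w && ~~ uniq w.
rewrite -[X in _ <= X + _]/(walk_sum k.+1 b (fun w => G w)).
under [X in _ <= _ + X]eq_bigr => l _ do
  rewrite -[X in _ * X]/(walk_sum l.+1 b (fun w => uniq w && (last b w == b)))
    -subSS -(walk_sum_take b (fun w => uniq w && (last b w == b)) (ltn_ord l)).
rewrite -walk_sum_sum -walk_sumD.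
apply: (@leq_walk_sum k.+1 b (fun w => nonbacktracking (b :: w) && ~~ uniq (b :: w))).
move=> w sw pw.
by apply: leq_trans (first_repetition pw) _; rewrite sw.
Qed.

Lemma repeating_walks0 : repeating_walks 0 = 0.
Proof. by rewrite /repeating_walks big1. Qed.

End regular.
End walks.

(** * Cycles in random regular graphs *)

Section switching.
Local Open Scope nat_scope.
Local Open Scope set_scope.
Variable n : nat.
Implicit Types (E : {set {set 'I_n}}) (i j u v x y c : 'I_n) (w : seq 'I_n).

Definition adj E : rel 'I_n := fun i j => [set i; j] \in E.

Lemma adj_sym E : symmetric (adj E).
Proof. by move=> i j; rewrite /adj finset.setUC. Qed.

Lemma adj_irr E : is_simple_graph E -> irreflexive (adj E).
Proof.
move=> /forall_inP sE i; apply/negbTE/negP => /sE.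
by rewrite finset.setUid cards1.
Qed.

Lemma degreeE E i : degree E i = #|[pred j | adj E i j]|.
Proof. by rewrite /degree cardsE. Qed.

(** Counting incident edges instead of neighbours lets [sum_exchange] compare the degrees before and
    after a switch. *)
Lemma degree_sum E i : is_simple_graph E -> degree E i = \sum_(a in E) (i \in a).
Proof.
move=> sE; have iE := adj_irr sE i; move/forall_inP : sE => sE.
rewrite -big_mkcondr sum1_card /degree.
rewrite -(card_in_imset (f := fun j => [set i; j])); last first.
  move=> j k; rewrite !inE => Ej Ek /setP eq_jk.
  have := eq_jk j; rewrite !inE eqxx orbT => /esym/orP[/eqP ji|/eqP//].
  by move: Ej; rewrite ji -/(adj E i i) iE.
apply: eq_card => a; apply/imsetP/andP => [[j]|[Ea ia]].
  by rewrite inE => Ej ->; rewrite Ej !inE eqxx.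
have /cards2P[k [l [kl ea]]] := sE _ Ea.
move: ia; rewrite ea !inE => /orP[/eqP ->|/eqP ->]; [exists l|exists k] => //.
  by rewrite inE -ea.
by rewrite inE finset.setUC -ea.
by rewrite finset.setUC.
Qed.

Definition switch u v x y E : {set {set 'I_n}} :=
  (E :\: [set [set u; v]; [set x; y]]) :|: [set [set u; x]; [set v; y]].

Lemma switchK u v x y E : adj E u v -> adj E x y -> ~~ adj E u x -> ~~ adj E v y ->
  switch u x v y (switch u v x y E) = E.
Proof.
rewrite /adj /switch => Euv Exy Eux Evy; apply/setP => a; rewrite !inE.
have [->|_] := eqVneq a [set u; v]; first by rewrite Euv !orbT.
have [->|_] := eqVneq a [set x; y]; first by rewrite Exy !orbT.
have [->|_] := eqVneq a [set u; x]; first by rewrite (negPf Eux).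
have [->|_] := eqVneq a [set v; y]; first by rewrite (negPf Evy).
by rewrite /= !orbF.
Qed.

Lemma eq_set2 i j x y :
  ([set i; j] == [set x; y]) = (i == x) && (j == y) || (i == y) && (j == x).
Proof.
apply/eqP/idP => [/setP e|/orP[] /andP[/eqP-> /eqP->]//]; last by rewrite finset.setUC.
have := e i; have := e j; have := e x; have := e y; rewrite !inE !eqxx ?orbT /=.
rewrite ![x == _]eq_sym ![y == _]eq_sym.
by do 4!case: eqP => ?; subst; rewrite ?eqxx.
Qed.

Lemma sum_exchange (T : finType) (f : T -> nat) (A : {set T}) (a b a' b' : T) :
  a \in A -> b \in A -> a != b -> a' \notin A -> b' \notin A -> a' != b' ->
  \sum_(t in (A :\: [set a; b]) :|: [set a'; b']) f t + (f a + f b) =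
  \sum_(t in A) f t + (f a' + f b').
Proof.
move=> aA bA ab a'A b'A a'b'.
have sum2 (x y : T) : x != y -> \sum_(t in [set x; y]) f t = f x + f y.
  by move=> xy; rewrite big_setU1 ?big_set1// inE.
rewrite -!sum2// [in RHS](big_setID [set a; b])/=.
rewrite (finset.setIidPr _); last by apply/fintype.subsetP => t; rewrite !inE => /orP[]/eqP->.
rewrite (big_setID [set a'; b'])/= (finset.setIidPr (finset.subsetUr _ _)).
have -> : (A :\: [set a; b] :|: [set a'; b']) :\: [set a'; b'] = A :\: [set a; b].
  apply/setP => t; rewrite !inE.
  have [->|_] := eqVneq t a'; first by rewrite (negPf a'A) andbF.
  have [->|_] := eqVneq t b'; first by rewrite (negPf b'A) andbF.
  by rewrite /= orbF.
by rewrite addnAC [RHS]addnAC [X in X + _ = _]addnC.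
Qed.

(** Each of the four vertices loses one edge and gains one. *)
Lemma switch_regular d u v x y E : uniq [:: u; v; x; y] ->
  E \in regular_graphs n d -> adj E u v -> adj E x y -> ~~ adj E u x ->
  ~~ adj E v y -> switch u v x y E \in regular_graphs n d.
Proof.
rewrite /= !inE !negb_or !andbT => /and3P[/and3P[uv ux uy] /andP[vx vy] xy].
move=> /andP[sE /forallP rE] Euv Exy Eux Evy.
have sE' : is_simple_graph (switch u v x y E).
  apply/forall_inP => a; rewrite !inE => /orP[/andP[_]|/orP[]/eqP->].
  - exact: (forall_inP sE).
  - by rewrite cards2 ux.
  - by rewrite cards2 vy.
rewrite sE'; apply/forallP => i; rewrite degree_sum//.
have := sum_exchange (fun a : {set 'I_n} => i \in a) Euv Exy _ Eux Evy.
rewrite !eq_set2 -[\sum_(t in E) _]degree_sum// (eqP (rE i)) !inE.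
rewrite (negPf ux) (negPf uy) (negPf uv) /= => /(_ isT isT).
have dis s t : s != t -> (i == s) || (i == t) = (i == s) + (i == t) :> nat.
  by move=> st; case: eqVneq => // ->; rewrite (negPf st).
by rewrite !dis// => /eqP; rewrite addnACA eqn_add2r.
Qed.

Lemma adj_switch u v x y E i j : adj (switch u v x y E) i j =
  [|| adj E i j && ([set i; j] \notin [set [set u; v]; [set x; y]]),
      [set i; j] == [set u; x] | [set i; j] == [set v; y]].
Proof. by rewrite /adj /switch !inE andbC. Qed.

(** * Switching away the edge that closes a given path *)

Section closing_edge.
Variables (d : nat) (c : 'I_n) (w : seq 'I_n).
Hypothesis uw : uniq (c :: w).
Hypothesis sw : 2 <= size w.
Let u := last c w.

Definition with_path := [set E in regular_graphs n d | path (adj E) c w].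

Let closed := [set E in with_path | adj E u c].

(** As [x] is off the path, removing [xy] spares the path; [y] may lie on it. That [y] differs from
    [u] follows, since [c] is adjacent to [u] but not to [y]. *)
Let switchable E x y :=
  [&& adj E x y, x \notin c :: w, ~~ adj E u x, y != c & ~~ adj E c y].

Let uc : u != c.
Proof.
apply: contraTneq uw; rewrite /u; case: (w) sw => //= a s _ <-.
by rewrite mem_last.
Qed.

Let switch_with_path E x y : E \in closed -> switchable E x y ->
  switch u c x y E \in with_path.
Proof.
rewrite !inE => /andP[/andP[/andP[sE rE] pE] Euc].
move=> /and5P[Exy xw Eux yc Ecy].
have xu : x != u by apply: contraNneq xw => ->; exact: mem_last.
have xc : x != c by apply: contraNneq xw => ->; exact: mem_head.
have yu : y != u by apply: contraNneq Ecy => ->; rewrite adj_sym.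
have xy : x != y by apply: contraTneq Exy => ->; rewrite adj_irr.
have := @switch_regular d u c x y E; rewrite !inE sE rE Euc Exy Eux Ecy.
rewrite /= !inE !negb_or uc xy [u == x]eq_sym xu [u == y]eq_sym yu.
rewrite [c == x]eq_sym xc [c == y]eq_sym yc => /(_ isT isT isT isT isT isT)/andP[-> ->] /=.
(* An edge of the path is not [xy], since it avoids [x]. Nor is it [uc]: the only edge of the path
   at [c] leads to the second vertex, which differs from [u] because [w] has size at least 2. *)
have keep i j : i \in w -> i != x -> j != x -> (j \in w) || (i != u) && (j == c) ->
    adj E i j -> adj (switch u c x y E) i j.
  move=> iw ix jx jw Eij; rewrite adj_switch Eij !inE !eq_set2.
  rewrite (negPf ix) (negPf jx) /= ?andbF ?orbF /=.
  have ic : i != c by apply: contraTneq uw => <- /=; rewrite iw.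
  rewrite (negPf ic) /= orbF; apply/orP; left.
  by case/orP: jw => [jw|/andP[/negPf->//]]; rewrite negb_and orbC;
    apply/orP; left; apply: contraTneq uw => <- /=; rewrite jw.
have xw' z : z \in w -> z != x by move=> zw; apply: contraNneq xw => <-; rewrite inE zw orbT.
move: pE uw; have lw : last c w = u by [].
case: (w) sw lw xw' keep => //= a s ss lw xw' keep /andP[Eca ps] /and3P[cas as_ us].
have au : a != u.
  apply: contraNneq as_ => ->; rewrite -lw.
  by case: (s) ss => //= b s' _; exact: mem_last.
apply/andP; split.
  rewrite adj_sym; apply: keep; first exact: mem_head.
  - exact/xw'/mem_head.
  - by rewrite eq_sym.
  - by rewrite au eqxx orbT.
  - by rewrite adj_sym.
apply: (@sub_in_path _ (mem (a :: s)) _ _ _ a s) ps; last exact/allP.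
by move=> i j ia ja; apply: keep => //; rewrite ?xw'// ja.
Qed.

(** Among the d n ordered edges (x, y), at most (size w + 1) d have [x] on the path, d^2 have [x]
    adjacent to [u], d have y = c, and d^2 have [y] adjacent to [c]. *)
Let card_switchable E : E \in closed ->
  d * n <= \sum_x \sum_y switchable E x y + d * (d.*2 + (size w).+2).
Proof.
rewrite !inE => /andP[/andP[/andP[sE rE] pE] Euc].
have deg i : \sum_j adj E i j = d.
  by rewrite -big_mkcondr sum1_card -degreeE; exact/eqP/(forallP rE).
have deg' i : \sum_j adj E j i = d by under eq_bigr do rewrite adj_sym.
have -> : d * n = \sum_x \sum_y adj E x y.
  by under eq_bigr do rewrite deg; rewrite sum_nat_const card_ord mulnC.
apply: (@leq_trans (\sum_x \sum_y (switchable E x y + ((x \in c :: w) * adj E x y +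
    adj E u x * adj E x y + (y == c) * adj E x y + adj E c y * adj E x y)))).
  apply: leq_sum => x _; apply: leq_sum => y _; rewrite /switchable.
  case: (adj E x y) => //=.
  by case: (x \in _); case: (adj E u x); case: (y == c); case: (adj E c y).
have -> : d * (d.*2 + (size w).+2) = (size w).+1 * d + d * d + d + d * d by lia.

under eq_bigr do rewrite big_split !big_split/=.
rewrite big_split/= leq_add2l !big_split/= !leq_add//.
- under eq_bigr do rewrite -big_distrr/= deg.
  rewrite -big_distrl/= leq_mul2r -big_mkcondr sum1_card.
  by apply/orP; right; exact: card_size.
- by under eq_bigr do rewrite -big_distrr/= deg; rewrite -big_distrl/= deg.
- rewrite exchange_big/=; under eq_bigr do rewrite -big_distrr/= deg'.
  by rewrite -big_distrl/= sum_indicator mul1n.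
- rewrite exchange_big/=; under eq_bigr do rewrite -big_distrr/= deg'.
  by rewrite -big_distrl/= deg.
Qed.

(* Double counting of the triples (E, x, y) with E closed and (x, y) switchable:
   E is recovered from x, y and the switched graph, in which x and y are
   neighbours of u and c respectively. *)
Lemma switching : #|closed| * (d * (n - (d.*2 + (size w).+2))) <= d ^ 2 * #|with_path|.
Proof.
apply: (@leq_trans (\sum_(E in closed) \sum_x \sum_y switchable E x y)).
  rewrite -sum_nat_const; apply: leq_sum => E /card_switchable.
  by rewrite mulnBr leq_subLR addnC.
under eq_bigr do rewrite pair_big.
rewrite exchange_big/=.
apply: (@leq_trans (\sum_(p : 'I_n * 'I_n) \sum_(E in with_path) (adj E u p.1 && adj E c p.2))).
  apply: leq_sum => -[x y] _ /=.
  rewrite -!big_mkcondr !sum1_card.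
  rewrite -(card_in_imset (f := switch u c x y)); last first.
    move=> E F /andP[+ /and5P[Exy _ Eux _ Ecy]] /andP[+ /and5P[Fxy _ Fux _ Fcy]].
    rewrite !inE => /andP[_ Euc] /andP[_ Fuc] EF.
    by rewrite -(switchK Euc Exy Eux Ecy) EF switchK.
  apply: subset_leq_card; apply/fintype.subsetP => _ /imsetP[E + ->].
  rewrite unfold_in => /andP[Ec Es]; rewrite unfold_in switch_with_path//.
  by rewrite !adj_switch !eqxx !orbT.
rewrite exchange_big/= mulnC -sum_nat_const; apply: leq_sum => E.
rewrite !inE => /andP[/andP[sE /forallP rE] _].
rewrite -(pair_big predT predT (fun x y => adj E u x && adj E c y : nat))/=.
under eq_bigr do under eq_bigr do rewrite -mulnb.
under eq_bigr do rewrite -big_distrr/= -big_mkcondr sum1_card -degreeE (eqP (rE _)).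
by rewrite -big_distrl/= -big_mkcondr sum1_card -degreeE (eqP (rE _)).
Qed.

End closing_edge.

(** * Mean numbers of cycles and of closed nonbacktracking walks *)

Section mean_cycles.
Variable d : nat.
Hypothesis d_gt0 : 0 < d.

Let reg E (EP : E \in regular_graphs n d) b : #|[pred c | adj E b c]| = d.
Proof. by move: EP; rewrite inE => /andP[_ /forallP /(_ b)/eqP]; rewrite degreeE. Qed.

(** [switching] is summed over all simple paths with [m] steps; on the right these are at most the n
    d^m walks of each graph. The assumption on [n] makes n - (2d + m + 2) at least n / 2, whence the
    factor 2. *)
Lemma sum_cyclic_walks m : 2 <= m -> (d.*2 + m.+2).*2 <= n ->
  \sum_(E in regular_graphs n d) cyclic_walks (adj E) m <=
    2 * d ^ m.+1 * #|regular_graphs n d|.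
Proof.
move=> m2 mn; set N := #|_|; set S := \sum_(E in _) _.
have : S * (d * (n - (d.*2 + m.+2))) <= d ^ 2 * (N * (n * d ^ m)).
  have -> : N * (n * d ^ m) = \sum_c \sum_(w : m.-tuple 'I_n) #|with_path d c w|.
    have -> : N * (n * d ^ m) =
        \sum_(E in regular_graphs n d) \sum_c walk_sum (adj E) m c (fun=> 1).
      rewrite -sum_nat_const; apply: eq_bigr => E EP.
      by under eq_bigr do rewrite (walk_sum1 (reg EP)); rewrite sum_nat_const card_ord.
    rewrite exchange_big/=; apply: eq_bigr => c _.
    under eq_bigr do rewrite walk_sumE big_mkcond/=.
    rewrite exchange_big/=; apply: eq_bigr => w _.
    rewrite -big_mkcondr sum1_card; apply: eq_card => E.
    by rewrite [LHS]unfold_in !inE.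
  have -> : S = \sum_c \sum_(w : m.-tuple 'I_n | uniq (c :: w))
      #|[set E in with_path d c w | adj E (last c w) c]|.
    rewrite /S exchange_big/=; apply: eq_bigr => c _.
    under eq_bigr do rewrite walk_sumE big_mkcond/=.
    rewrite exchange_big/= [RHS]big_mkcond/=; apply: eq_bigr => w _.
    rewrite /=; case: (_ && uniq w) => /=; last by rewrite big1// => E _; case: ifP.
    rewrite -sum1_card -big_mkcondr [RHS]big_mkcond [LHS]big_mkcond/=.
    apply: eq_bigr => E _; rewrite !inE.
    by case: (is_simple_graph E && _ && path (adj E) c w); case: (adj E _ c).
  rewrite big_distrl big_distrr/=; apply: leq_sum => c _.
  rewrite big_distrl big_distrr/= [leqRHS](bigID (fun w : m.-tuple 'I_n => uniq (c :: w)))/=.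
  apply: leq_trans (leq_addr _ _); apply: leq_sum => w uw.
  by have := @switching d c w uw; rewrite size_tuple => /(_ m2).
move=> H; have n0 : 0 < d * n by rewrite muln_gt0 d_gt0; lia.
rewrite -(leq_pmul2r n0).
apply: (@leq_trans (S * (d * (n - (d.*2 + m.+2))) * 2)).
  by rewrite -!mulnA leq_mul2l leq_mul2l; apply/orP; right; apply/orP; right; lia.
apply: (leq_trans (leq_mul H (leqnn 2))); rewrite (expnS d m).
by apply: eq_leq; ring.
Qed.

(** Iteration of [repeating_walksS]: the step from j to j + 1 multiplies the bound by d and adds at
    most j + 1 cycle terms, each at most 2 d^(j+1) times the number of graphs; and j^2 + (j + 1) <=
    (j + 1)^2. *)
Lemma sum_trace_nbwalks k : (d.*2 + k.+2).*2 <= n ->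
  \sum_(E in regular_graphs n d) \sum_b nbwalks (adj E) k.+1 b b <=
    k.+1 ^ 2 * (2 * d ^ k.+1 * #|regular_graphs n d|).
Proof.
move=> kn; set N := #|_|.
apply: (@leq_trans (\sum_(E in regular_graphs n d) repeating_walks (adj E) k.+1)).
  by apply: leq_sum => E _; exact: trace_nbwalks_le.
elim: {1 3 4 5}k.+1 (leqnn k.+1) => [|j IH] jk.
  by rewrite big1// => E _; exact: repeating_walks0.
apply: (@leq_trans (d * (j ^ 2 * (2 * d ^ j * N)) + j.+1 * (2 * d ^ j.+1 * N))).
  apply: (@leq_trans (\sum_(E in regular_graphs n d) (d * repeating_walks (adj E) j +
      \sum_(l < j.+1 | 2 <= l) d ^ (j - l) * cyclic_walks (adj E) l))).
    apply: leq_sum => E EP; apply: repeating_walksS; last exact: reg.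
    - exact: adj_sym.
    - by apply: adj_irr; move: EP; rewrite inE => /andP[].
  rewrite big_split/= -big_distrr/= leq_add ?leq_mul2l ?IH ?orbT//; first exact: ltnW.
  rewrite exchange_big/= big_mkcond/=.
  rewrite -[X in _ <= X * _](card_ord j.+1) -sum_nat_const; apply: leq_sum => l _.
  case: ifPn => // l2; rewrite -big_distrr/=.
  apply: (@leq_trans (d ^ (j - l) * (2 * d ^ l.+1 * N))).
    rewrite leq_mul2l sum_cyclic_walks ?orbT//.
    by apply: leq_trans kn; rewrite leq_double leq_add2l; have := ltn_ord l; lia.
  have -> : d ^ j.+1 = d ^ (j - l) * d ^ l.+1.
    by rewrite -expnD; congr (_ ^ _); have := ltn_ord l; lia.
  by apply: eq_leq; ring.
have -> : d * (j ^ 2 * (2 * d ^ j * N)) = j ^ 2 * (2 * d ^ j.+1 * N) by rewrite (expnS d j); ring.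
by rewrite -mulnDl leq_mul2r; apply/orP; right; rewrite !expnS expn0; lia.
Qed.

End mean_cycles.

End switching.

(** * Existence of regular graphs *)

Section circulant.
Local Open Scope nat_scope.
Local Open Scope set_scope.

(** The Cayley graph of the cyclic group ['I_n.+1] with connection set [D]: D = -D makes adjacency
    symmetric, and excluding 0 prevents loops. *)
Lemma circulant_regular n (D : {set 'I_n.+1}) : (0%R : 'I_n.+1) \notin D ->
  (forall x : 'I_n.+1, x \in D -> (- x)%R \in D) -> regular_graphs n.+1 #|D| != finset.set0.
Proof.
move=> D0 DN; apply/set0Pn.
pose E := [set [set p.1; p.2] | p in [set p : 'I_n.+1 * 'I_n.+1 | (p.2 - p.1)%R \in D]].
have EE i j : ([set i; j] \in E) = ((j - i)%R \in D).
  apply/imsetP/idP => [[[k l]]|Dij]; last by exists (i, j); rewrite ?inE.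
  rewrite inE => /= Dkl /eqP; rewrite eq_set2 => /orP[]/andP[/eqP-> /eqP->] //.
  by rewrite -opprB; exact: DN.
exists E; rewrite inE; apply/andP; split.
  apply/forall_inP => _ /imsetP[[k l] + ->] /=; rewrite inE /= cards2.
  by have [->|] := eqVneq k l; rewrite // subrr (negPf D0).
apply/forallP => i; apply/eqP; rewrite /degree.
under eq_finset do rewrite EE.
rewrite -[RHS](card_imset _ (@addIr _ i)); apply: eq_card => j.
rewrite !inE; apply/idP/imsetP => [Dj|[k Dk ->]]; last by rewrite addrK.
by exists (j - i)%R; rewrite ?subrK.
Qed.

(** The connection set consists of the residues 1, ..., h with h = d./2, their opposites and, for
    odd d, the residue of order 2, available because the number of vertices is then even. *)
Lemma regular_graphs_neq0 n d : d < n -> ~~ odd (n * d) ->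
  regular_graphs n d != finset.set0.
Proof.
case: n => // n dn nd; pose h := d./2.
pose P x := (0 < x) && [|| x <= h, n.+1 - h <= x | odd d && (x.*2 == n.+1)].
have hd : d = odd d + h.*2 by rewrite odd_double_half.
have <- : #|[set x : 'I_n.+1 | P x]| = d.
  rewrite cardsE -sum1_card -(big_mkord P (fun=> 1)) sum1_count /index_iota subn0.
  have -> : n.+1 = (1 + h) + ((n.+1 - h.*2.+1) + h) by lia.
  rewrite iotaD count_cat iotaD count_cat add0n iotaD count_cat.
  have -> : count P (iota 0 1) = 0 by [].
  have -> : count P (iota 1 h) = h.
    rewrite -[RHS](size_iota 1 h) -count_predT; apply: eq_in_count => x.
    by rewrite mem_iota /P /=; lia.
  have -> : count P (iota (1 + h + (n.+1 - h.*2.+1)) h) = h.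
    rewrite -[RHS](size_iota (1 + h + (n.+1 - h.*2.+1)) h) -count_predT; apply: eq_in_count => x.
    by rewrite mem_iota /P /=; lia.
  have -> : count P (iota (1 + h) (n.+1 - h.*2.+1)) = odd d.
    rewrite (@eq_in_count _ _ (fun x => odd d && (x == n.+1./2))); last first.
      by move=> x; rewrite mem_iota /P; move: nd; rewrite oddM; lia.
    case od: (odd d); last by rewrite count_pred0.
    rewrite (@eq_count _ _ (pred1 n.+1./2))// count_uniq_mem ?iota_uniq// mem_iota.
    by move: nd; rewrite oddM od; lia.
  lia.
apply: circulant_regular; first by rewrite inE.
move=> x; rewrite !inE => Px; have x0 : 0 < x by case/andP: Px.
have -> : nat_of_ord (- x)%R = n.+1 - x by rewrite /= modn_small//; lia.
by move: Px; rewrite /P; have := ltn_ord x; lia.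
Qed.

End circulant.

(** * Chebyshev polynomials of the adjacency matrix *)

Section spectral.
Local Open Scope ring_scope.

Lemma char_poly_conj (F : fieldType) n (P A : 'M[F]_n) : P \in unitmx ->
  char_poly (invmx P *m A *m P) = char_poly A.
Proof.
move=> Pu; rewrite /char_poly.
have -> : char_poly_mx (invmx P *m A *m P) =
    map_mx polyC (invmx P) *m char_poly_mx A *m map_mx polyC P.
  rewrite /char_poly_mx mulmxBr mulmxBl !map_mxM; congr (_ - _).
  by rewrite -mulmxA -[X in _ *m X]scalar_mxC mulmxA -map_mxM mulVmx// map_mx1 mul1mx.
rewrite !det_mulmx mulrC mulrA -det_mulmx -map_mxM mulmxV// map_mx1 det1.
by rewrite mul1r.
Qed.

Variable R : realType.

(** The matrix is diagonalised over [R[i]]. As [eigenvalues A] is known only through the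
    characteristic polynomial, unique factorisation identifies it, up to order, with the
    diagonal. *)
Lemma trace_horner_mx n (A : 'M[R]_n.+1) (p : {poly R}) : A^T = A ->
  \tr (horner_mx A p) = \sum_(a <- eigenvalues A) p.[a].
Proof.
move=> symA; set f : {rmorphism R -> R[i]} := real_complex R.
pose B := map_mx f A.
have Breal : B \is a mxOver Num.real.
  by apply/mxOverP => i j; rewrite mxE; apply/complex_realP; exists (A i j).
have Bherm : B \is hermsymmx.
  apply: realsym_hermsym => //.
  by apply/is_hermitianmxP; rewrite expr0 scale1r map_mx_id// /B map_trmx symA.
have /orthomx_spectralP := hermitian_normalmx Bherm.
set P := spectralmx B; set sp := spectral_diag B => eB.
have Pu : P \in unitmx := spectral_unit B.
have cB : char_poly B = \prod_(a <- codom (sp 0)) ('X - a%:P).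
  rewrite eB char_poly_conj// char_poly_trig ?diag_mx_is_trig// big_image/=.
  by apply: eq_bigr => i _; rewrite mxE eqxx mulr1n.
have /prod_XsubC_eq eq_sp : \prod_(a <- map f (eigenvalues A)) ('X - a%:P) =
    \prod_(a <- codom (sp 0)) ('X - a%:P).
  rewrite -cB -map_char_poly (char_poly_eigenvalues symA) rmorph_prod big_map/=.
  by apply: eq_bigr => a _; rewrite rmorphB/= map_polyX map_polyC.
apply: (fmorph_inj f); rewrite -trace_map_mx map_horner_mx -/B.
rewrite [in LHS]eB horner_mx_uconjC// horner_mx_diag mxtrace_mulC mulmxA mulmxV// mul1mx.
rewrite mxtrace_diag rmorph_sum/=.
transitivity (\sum_(a <- codom (sp 0)) (map_poly f p).[a]).
  by rewrite big_image/=; apply: eq_bigr => i _; rewrite mxE.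
rewrite -(perm_big _ eq_sp) big_map/=; apply: eq_bigr => a _.
by rewrite horner_map.
Qed.

End spectral.

(** * Chebyshev polynomials of the second kind *)

Section chebyshev.
Local Open Scope ring_scope.
Variable R : realType.

(* [cheb k] is the rescaled Chebyshev polynomial of the second kind
   [U_k(X / 2)]. *)
Fixpoint cheb (k : nat) : {poly R} :=
  if k is k'.+1 then
    if k' is k''.+1 then 'X * cheb k' - cheb k'' else 'X
  else 1.

Lemma chebSS k : cheb k.+2 = 'X * cheb k.+1 - cheb k.
Proof. by []. Qed.

(** By the addition formulas, sin((k+3)t) + sin((k+1)t) = 2 cos t sin((k+2)t), which is the
    recurrence of [cheb]. *)
Lemma cheb_sin k (t : R) : (cheb k).[2 * cos t] * sin t = sin (k.+1%:R * t).
Proof.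
elim/ltn_ind: k => -[|[|k]] IH.
- by rewrite hornerC !mul1r.
- by rewrite hornerX [2 * t]mulr_natl mulr2n sinD; ring.
- rewrite chebSS !hornerE mulrBl IH// -mulrA IH//.
  have -> : k.+3%:R * t = k.+2%:R * t + t by rewrite -[k.+3]addn1 natrD; ring.
  have -> : k.+1%:R * t = k.+2%:R * t - t by rewrite -[k.+2]addn1 natrD; ring.
  by rewrite sinB sinD; ring.
Qed.

Definition linear_closed (P : {poly R} -> Prop) :=
  (forall p q, P p -> P q -> P (p + q)) /\ (forall c p, P p -> P (c *: p)).

(** The span of the [cheb k] contains 1 and is stable under multiplication by ['X], since
    ['X * cheb k.+1] is the sum of [cheb k.+2] and [cheb k]. *)
Lemma cheb_ind (P : {poly R} -> Prop) :
  linear_closed P -> (forall k, P (cheb k)) -> forall p, P p.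
Proof.
move=> lP Pcheb p.
(* The span itself, as the intersection of all linearly closed predicates containing the family; [P]
   alone need not be stable under multiplication by ['X]. *)
pose S q := forall Q, linear_closed Q -> (forall k, Q (cheb k)) -> Q q.
have Scheb k : S (cheb k) by move=> Q _; exact.
have SD q r : S q -> S r -> S (q + r).
  by move=> Sq Sr Q lQ cQ; apply: lQ.1; [exact: Sq|exact: Sr].
have SZ c q : S q -> S (c *: q).
  by move=> Sq Q lQ cQ; apply: lQ.2; exact: Sq.
have SX q : S q -> S ('X * q).
  move=> /(_ (fun q => S ('X * q))); apply.
    split=> [r r' Sr Sr'|c r Sr]; first by rewrite mulrDr; exact: SD.
    by rewrite -scalerAr; exact: SZ.
  case=> [|k]; first by rewrite mulr1; exact: (Scheb 1%N).
  have -> : 'X * cheb k.+1 = cheb k.+2 + 1 *: cheb k by rewrite chebSS scale1r subrK.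
  by apply: SD => //; apply: SZ.
suff : S p by apply.
elim/poly_ind: p => [|q c Sq]; first by rewrite -(scale0r (cheb 0)); apply: SZ; exact: Scheb.
apply: SD; first by rewrite mulrC; exact: SX.
by rewrite -[c%:P]mulr1 mul_polyC; apply: SZ (Scheb 0%N).
Qed.

End chebyshev.

Section nbwalks_matrix.
Local Open Scope ring_scope.
Variable R : realType.
Variables (n d : nat) (E : {set {set 'I_n.+1}}).
Hypothesis EP : E \in regular_graphs n.+1 d.
Hypothesis d_gt1 : (1 < d)%N.

Let s : R := Num.sqrt (d%:R - 1).
Let A : 'M[R]_n.+1 := s^-1 *: adjacency R E.

Let nbmx k : 'M[R]_n.+1 := \matrix_(b, v) (nbwalks (adj E) k b v)%:R.

Let s_gt0 : 0 < s.
Proof. by rewrite sqrtr_gt0 subr_gt0 ltr1n. Qed.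

Let s2 : s ^+ 2 = d%:R - 1.
Proof. by rewrite sqr_sqrtr// subr_ge0 ler1n ltnW. Qed.

Let reg b : #|[pred c | adj E b c]| = d.
Proof. by move: EP; rewrite inE => /andP[_ /forallP /(_ b)/eqP]; rewrite degreeE. Qed.

Let nbmx0 : nbmx 0 = 1%:M.
Proof. by apply/matrixP => b v; rewrite !mxE nbwalks0. Qed.

Let nbmx1 : nbmx 1 = adjacency R E.
Proof. by apply/matrixP => b v; rewrite !mxE nbwalks1. Qed.

Let nbmxSS k : nbmx k.+2 =
  adjacency R E *m nbmx k.+1 - (if k == 0%N then d else d.-1)%:R *: nbmx k.
Proof.
apply/matrixP => b v; rewrite !mxE.
apply/eqP; rewrite eq_sym subr_eq -natrM -natrD -nbwalksSS//; last exact: adj_sym.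
apply/eqP; rewrite natr_sum [RHS]big_mkcond/=; apply: eq_bigr => c _.
by rewrite !mxE -/(adj E b c); case: (adj E b c); rewrite ?mul1r ?mul0r.
Qed.

(* The correction by [cheb k.-2] accounts for the root having d instead of d - 1
   children. *)
Let corrected k : {poly R} :=
  cheb R k - (d%:R - 1)^-1 *: (if k is k'.+2 then cheb R k' else 0).

Let nbmxE k : nbmx k = s ^+ k *: horner_mx A (corrected k).
Proof.
have s0 : s != 0 by rewrite gt_eqF.
have adE : adjacency R E = s *: A by rewrite scalerA divff// scale1r.
elim/ltn_ind: k => -[|[|k]] IH.
- by rewrite nbmx0 /corrected /= scaler0 subr0 !rmorph1 expr0 scale1r.
- by rewrite nbmx1 /corrected scaler0 subr0 horner_mx_X expr1.
rewrite nbmxSS !IH// adE.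
rewrite -scalemxAl -scalemxAr !scalerA -exprS.
have -> : A *m horner_mx A (corrected k.+1) = horner_mx A ('X * corrected k.+1).
  by rewrite rmorphM/= horner_mx_X.
rewrite -!horner_mxZ -rmorphB; congr (horner_mx A _).
have a0 : d%:R - 1 != 0 :> R by rewrite -s2 expf_neq0.
have dE : (d.-1)%:R = s ^+ 2 by rewrite s2 -subn1 natrB// ltnW.
(* At k = 0 the coefficient d = (d - 1)(1 + 1 / (d - 1)) creates the first correction; at k = 1 the
   term [corrected 1] has none yet; afterwards the corrections obey the Chebyshev recurrence
   themselves. *)
case: k {IH} => [|[|k]] /=.
- rewrite /corrected !scaler0 !subr0 expr0 mulr1 chebSS !scalerBr scalerA s2 divff//.
  by rewrite -addrA -opprD -scalerDl subrK.
- rewrite /corrected !scaler0 !subr0 dE -exprD -scalerBr; congr (_ *: _).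
  by rewrite chebSS; rewrite /= mulrBr -!scalerAr mulr1 addrAC.
rewrite /corrected dE -exprD -scalerBr; congr (_ *: _).
rewrite (chebSS R k.+2) (chebSS R k) mulrBr scalerBr -!scalerAr.
by rewrite -!mul_polyC; ring.
Qed.

Lemma trace_nbwalks k :
  (\sum_b nbwalks (adj E) k.+2 b b)%:R / s ^+ k.+2 =
  \sum_(a <- eigenvalues A) (cheb R k.+2).[a] -
  (d%:R - 1)^-1 * \sum_(a <- eigenvalues A) (cheb R k).[a].
Proof.
have symA : A^T = A by rewrite linearZ/= adjacency_sym.
have s0 : s != 0 by rewrite gt_eqF.
have -> : (\sum_b nbwalks (adj E) k.+2 b b)%:R = \tr (nbmx k.+2).
  by rewrite natr_sum; apply: eq_bigr => b _; rewrite mxE.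
rewrite nbmxE linearZ/= mulrAC divff ?expf_neq0// mul1r rmorphB/= linearB/=.
by rewrite horner_mxZ linearZ/= !trace_horner_mx.
Qed.

Lemma trace_nbwalks1 :
  (\sum_b nbwalks (adj E) 1 b b)%:R / s = \sum_(a <- eigenvalues A) (cheb R 1).[a].
Proof.
have symA : A^T = A by rewrite linearZ/= adjacency_sym.
rewrite -trace_horner_mx// horner_mx_X linearZ/= mulrC; congr (_ * _).
by rewrite natr_sum; apply: eq_bigr => b _; rewrite nbwalks1 mxE.
Qed.

End nbwalks_matrix.

(** * Weierstrass approximation *)

Section weierstrass.
Local Open Scope classical_set_scope.
Local Open Scope ring_scope.
Variable R : realType.
Implicit Types (f : R -> R) (g : nat -> R) (x y : R).

(* The Bernstein polynomial [\sum_(k <= n) g k * 'C(n, k) X^k (1 - X)^(n - k)],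
   by Pascal's rule; at [x] it is the mean of [g] under the binomial law with
   parameters [n] and [x]. *)
Fixpoint bernstein n g : {poly R} :=
  if n is n'.+1 then
    (1 - 'X) * bernstein n' g + 'X * bernstein n' (fun k => g k.+1)
  else (g 0%N)%:P.

Lemma bernsteinS n g x : (bernstein n.+1 g).[x] =
  (1 - x) * (bernstein n g).[x] + x * (bernstein n (fun k => g k.+1)).[x].
Proof. by rewrite /= !hornerE. Qed.

Lemma bernstein_cst n (c : R) x : (bernstein n (fun=> c)).[x] = c.
Proof. by elim: n => [|n IH]; rewrite ?bernsteinS ?IH /= ?hornerC //; ring. Qed.

Lemma bernsteinB n g g' x : (bernstein n (fun k => g k - g' k)).[x] =
  (bernstein n g).[x] - (bernstein n g').[x].
Proof.
elim: n g g' => [|n IH] g g'; first by rewrite /= !hornerC.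
by rewrite !bernsteinS IH (IH (fun k => g k.+1)); ring.
Qed.

(** The second moment of the binomial law about [c] is the squared bias plus the variance n x (1 -
    x). An arbitrary [c] is needed for the induction, where the shift of [k] turns [c] into c -
    1. *)
Lemma bernstein_quad n (a b c : R) x :
  (bernstein n (fun k => a + b * (k%:R - c) ^+ 2)).[x] =
  a + b * ((n%:R * x - c) ^+ 2 + n%:R * (x * (1 - x))).
Proof.
elim: n c => [|n IH] c; first by rewrite /= hornerC; ring.
rewrite bernsteinS IH.
have -> : (fun k => a + b * (k.+1%:R - c) ^+ 2) = (fun k => a + b * (k%:R - (c - 1)) ^+ 2).
  by apply/funext => k; rewrite -natr1; ring.
by rewrite IH -natr1; ring.
Qed.

Lemma normr_bernstein_le n g g' x : 0 <= x <= 1 -> (forall k, `|g k| <= g' k) ->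
  `|(bernstein n g).[x]| <= (bernstein n g').[x].
Proof.
move=> /andP[x0 x1]; elim: n g g' => [|n IH] g g' gg'; first by rewrite /= !hornerC.
rewrite !bernsteinS (le_trans (ler_normD _ _))// !normrM (ger0_norm x0).
rewrite (ger0_norm (_ : 0 <= 1 - x)) ?subr_ge0// lerD// ler_wpM2l ?subr_ge0//; exact: IH.
Qed.

(** Only [x] is confined to the segment: [normr_bernstein_le] asks for a bound at every [k], hence
    also at nodes beyond 1. *)
Lemma uniform_continuity_segment f a b (e : R) : continuous f -> 0 < e ->
  exists2 r : R, 0 < r & forall x y, a <= x <= b -> `|x - y| < r -> `|f x - f y| < e.
Proof.
move=> cf e0.
pose P (r x : R) := forall y, `|x - y| < r -> `|f x - f y| < e.
suff Pab : \forall r \near (0 : R)^'+, `[a, b] `<=` P r.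
  have [r [r0 Pr]] := filter_ex (filterI (nbhs_right_gt (0 : R)) Pab).
  by exists r => // x y xab; apply: Pr; rewrite /= in_itv.
apply: (compact_near_coveringP `[a, b]).1; first exact: segment_compact.
move=> x _.
have /cvgrPdist_lt/(_ (e / 2)) := cf x.
rewrite divr_gt0// => /(_ isT) /nbhs_ballP[r /= r0 fr].
exists (ball x (r / 2), [set s | 0 < s < r / 2]) => /=.
  split; first by apply: nbhsx_ballx; rewrite divr_gt0.
  near=> s; apply/andP; split; near: s; first exact: nbhs_right_gt.
  by apply: nbhs_right_lt; rewrite divr_gt0.
move=> [x' s] /= [xx' /andP[s0 sr]] y x'y.
have fxx' : `|f x - f x'| < e / 2.
  apply: fr; apply: le_ball xx'; rewrite ler_pdivrMr//; lra.
have fxy : `|f x - f y| < e / 2.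
  apply: fr; rewrite /ball/= in xx' *; rewrite -(subrK x' x) -addrA (le_lt_trans (ler_normD _ _))//.
  rewrite [ltRHS]splitr ltrD//; exact: lt_trans x'y sr.
rewrite -(subrK (f x) (f x')) -addrA (le_lt_trans (ler_normD _ _))// [ltRHS]splitr ltrD//.
by rewrite distrC.
Unshelve. all: by end_near.
Qed.

Lemma weierstrass01 f (M e : R) : continuous f -> (forall x, `|f x| <= M) -> 0 < e ->
  exists p : {poly R}, forall x, 0 <= x <= 1 -> `|f x - p.[x]| <= e.
Proof.
move=> cf fM e0.
have M0 : 0 <= M := le_trans (normr_ge0 _) (fM 0).
have [r r0 fr] := @uniform_continuity_segment f 0 1 (e / 2) cf (divr_gt0 e0 (ltr0n _ 2)).
(* With this constant C (y - x)^2 is at least 2M once |x - y| >= r. The quadratic bound [key] then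
   averages, by [bernstein_quad], to e / 2 + C x (1 - x) / N. *)
pose C := 2 * M / r ^+ 2.
have C0 : 0 <= C by apply: divr_ge0; [exact: mulr_ge0|exact: sqr_ge0].
have key x y : 0 <= x <= 1 -> `|f x - f y| <= e / 2 + C * (y - x) ^+ 2.
  move=> x01; have [xy|xy] := ltP `|x - y| r.
    by rewrite (le_trans (ltW (fr _ _ x01 xy)))// lerDl mulr_ge0// sqr_ge0.
  rewrite (le_trans (ler_normB _ _))// (le_trans (lerD (fM x) (fM y)))//.
  rewrite ler_wpDl ?divr_ge0 ?(ltW e0)//.
  rewrite -mulr2n -mulr_natl /C -mulrA ler_peMr ?mulr_ge0//.
  rewrite mulrC ler_pdivlMr ?exprn_gt0// mul1r -[(y - x) ^+ 2]real_normK ?num_real//.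
  by rewrite lerXn2r ?nnegrE ?normr_ge0 ?(ltW r0)// distrC.
have [n nC] : exists n, C <= e / 2 * n.+1%:R.
  exists (Num.truncn (C / (e / 2))).
  by rewrite mulrC -ler_pdivrMr ?divr_gt0// ltW// truncnS_gt// divr_ge0// divr_ge0// ltW.
pose N : R := n.+1%:R.
have N0 : 0 < N by rewrite ltr0n.
exists (bernstein n.+1 (fun k => f (k%:R / N))) => x x01.
rewrite distrC -[f x](bernstein_cst n.+1 _ x) -bernsteinB.
have kx k : `|f (k%:R / N) - f x| <= e / 2 + C / N ^+ 2 * (k%:R - N * x) ^+ 2.
  rewrite distrC (le_trans (key _ _ x01))// lerD2l le_eqVlt; apply/orP; left; apply/eqP.
  by field; rewrite gt_eqF.
apply: (le_trans (normr_bernstein_le _ x01 kx)).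
rewrite bernstein_quad subrr expr0n add0r [leRHS]splitr lerD2l.
move/andP : x01 => [x0 x1].
apply: (@le_trans _ _ (C / N)); last by rewrite ler_pdivrMr.
have -> : C / N ^+ 2 * (n.+1%:R * (x * (1 - x))) = C / N * (x * (1 - x)).
  by rewrite -/N; field; rewrite gt_eqF.
by apply: ler_piMr; [rewrite divr_ge0// ltW|nra].
Qed.

Lemma weierstrass f (M e a b : R) : a < b -> continuous f -> (forall x, `|f x| <= M) ->
  0 < e -> exists p : {poly R}, forall x, a <= x <= b -> `|f x - p.[x]| <= e.
Proof.
move=> ab cf fM e0; have ba0 : 0 < b - a by rewrite subr_gt0.
have [||p fp] := @weierstrass01 (fun t => f (a + (b - a) * t)) M e _ _ e0.
- move=> t; apply: (@continuous_comp _ _ _ (fun t => a + (b - a) * t) f); last exact: cf.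
  by apply: cvgD; [exact: cvg_cst|apply: cvgM; [exact: cvg_cst|exact: cvg_id]].
- by move=> x; exact: fM.
exists (p \Po ((b - a)^-1 *: ('X - a%:P))) => x /andP[ax xb].
rewrite horner_comp !hornerE.
have := fp ((b - a)^-1 * (x - a)).
have -> : a + (b - a) * ((b - a)^-1 * (x - a)) = x by field; rewrite gt_eqF.
apply; apply/andP; split.
  by rewrite mulr_ge0 ?invr_ge0 ?subr_ge0// ltW.
by rewrite mulrC ler_pdivrMr// mul1r lerD2r.
Qed.

End weierstrass.

(** * Integration against the semicircle law *)

Section semicircle_integral.
Local Open Scope classical_set_scope.
Local Open Scope ring_scope.
Variable R : realType.
Notation mu := (@lebesgue_measure R).
Implicit Types (f h : R -> R) (p : {poly R}).

Lemma semicircle_pdfE (x : R) : semicircle_pdf x = (2 * pi)^-1 * Num.sqrt (4 - x ^+ 2).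
Proof.
rewrite /semicircle_pdf; case: ifPn => // /negP xlt.
rewrite ler0_sqrtr ?mulr0// leNgt; apply/negP => h; apply: xlt.
by apply/andP; split; nra.
Qed.

Lemma continuous_semicircle_pdf : continuous (@semicircle_pdf R).
Proof.
have -> : @semicircle_pdf R = fun x => (2 * pi)^-1 * Num.sqrt (4 - x ^+ 2).
  by apply/funext => x; exact: semicircle_pdfE.
move=> x; apply: cvgM; first exact: cvg_cst.
apply: (@continuous_comp _ _ _ (fun x : R => 4 - x ^+ 2) (@Num.sqrt R));
  last exact: sqrt_continuous.
by apply: cvgB; [exact: cvg_cst|exact: exprn_continuous].
Qed.

(** Restricted to the compact support, where every continuous function is integrable, polynomials
    included. *)
Definition semicircle_integral f : R :=
  \int[mu]_(x in `[-2, 2]) (f x * semicircle_pdf x).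
Local Notation L := semicircle_integral.

Lemma integrable_semicircle f : continuous f ->
  mu.-integrable `[-2, 2] (EFin \o (fun x => f x * semicircle_pdf x)).
Proof.
move=> cf; apply: continuous_compact_integrable; first exact: segment_compact.
apply: continuous_subspaceT => x.
by apply: cvgM; [exact: cf|exact: continuous_semicircle_pdf].
Qed.

Lemma semicircle_integralD f h : continuous f -> continuous h ->
  L (fun x => f x + h x) = L f + L h.
Proof.
move=> cf ch; rewrite /L -RintegralD//; try exact: integrable_semicircle.
by apply: eq_Rintegral => x _; rewrite mulrDl.
Qed.

Lemma semicircle_integralZ c f : continuous f -> L (fun x => c * f x) = c * L f.
Proof.
move=> cf; rewrite /L -RintegralZl//; last exact: integrable_semicircle.
by apply: eq_Rintegral => x _; rewrite mulrA.
Qed.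

Lemma semicircle_integral1 : L (fun=> 1) = 1.
Proof.
rewrite /L /Rintegral.
have -> : (\int[mu]_(x in `[(-2)%R, 2%R]) (1 * semicircle_pdf x)%:E = 1)%E; last by [].
rewrite -[RHS](@integral_semicircle_pdf R) [LHS]integral_mkcond.
apply: eq_integral => x _; rewrite patchE mul1r; case: ifPn => // /negP xn.
rewrite /semicircle_pdf ifF//; apply/negP => /andP[x1 x2]; apply: xn.
by rewrite inE/= in_itv/= !ltW.
Qed.

Lemma le_semicircle_integral f h : continuous f -> continuous h ->
  (forall x, -2 <= x <= 2 -> f x <= h x) -> L f <= L h.
Proof.
move=> cf ch fh; apply: le_Rintegral => //; try exact: integrable_semicircle.
move=> x; rewrite /= in_itv/= => xI; rewrite ler_wpM2r ?fh//.
exact: semicircle_pdf_ge0.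
Qed.

Lemma semicircle_integral_le f c : continuous f ->
  (forall x, -2 <= x <= 2 -> `|f x| <= c) -> `|L f| <= c.
Proof.
move=> cf fc.
have Lc e : L (fun=> e) = e.
  rewrite -[RHS]mulr1 -[X in _ = _ * X]semicircle_integral1.
  by rewrite -semicircle_integralZ ?mulr1// => x; exact: cvg_cst.
have cc (e : R) : continuous (fun _ : R => e) by move=> x; exact: cvg_cst.
rewrite ler_norml; apply/andP; split.
  rewrite -[leLHS]Lc; apply: le_semicircle_integral => // x /fc.
  by rewrite ler_norml => /andP[].
rewrite -[leRHS]Lc; apply: le_semicircle_integral => // x /fc.
by rewrite ler_norml => /andP[].
Qed.

Lemma semicircle_dominates : (@semicircle_law R) `<< mu.
Proof.
apply/null_content_dominatesP => A mA muA0; rewrite /= /semicircle_law.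
apply: null_set_integral => //; apply: measurable_funTS; apply/measurable_EFinP.
exact: measurable_semicircle_pdf.
Qed.

(** The Radon-Nikodym derivative of the law agrees almost everywhere with [semicircle_pdf], both
    having the same integral over every measurable set. *)
Lemma integral_semicircle_law (f : R -> \bar R) : measurable_fun setT f ->
  (\int[@semicircle_law R]_x `|f x| < +oo)%E ->
  (\int[@semicircle_law R]_x f x = \int[mu]_x (f x * (semicircle_pdf x)%:E))%E.
Proof.
move=> mf finf.
have mp := @measurable_semicircle_pdf R.
rewrite -(Radon_Nikodym_change_of_variables semicircle_dominates)//=; last exact/integrableP.
apply: ae_eq_integral => //.
- apply: emeasurable_funM => //; apply: (measurable_int mu).
  by apply: Radon_Nikodym_integrable; exact: semicircle_dominates.
- by apply: emeasurable_funM => //=; exact/measurable_EFinP.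
- apply: ae_eqe_mul2l => /=.
  rewrite Radon_NikodymE//=; first exact: semicircle_dominates.
  move=> abmu.
  case: cid => /= h [h1 h2 h3].
  apply: integral_ae_eq => //=.
  + exact/measurable_EFinP.
  + by move=> E _ mE; rewrite -h3.
Qed.

Lemma integral_of_semicircle (f : bounded_continuous R) :
  integral_of f semicircle_law = L (sval f).
Proof.
have [cf [M [_ fM]]] := svalP f.
rewrite /integral_of /L; move: (sval f) cf fM => g cg gM.
have mf : measurable_fun setT g by exact: continuous_measurable_fun.
rewrite /Rintegral; congr fine.
rewrite (@integral_semicircle_law (EFin \o g)); first last.
- apply: (@le_lt_trans _ _ (\int[@semicircle_law R]_x (cst (M + 1)%:E x))%E).
    apply: ge0_le_integral => //.
    + by apply: measurableT_comp => //; exact/measurable_EFinP.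
    + move=> x _; rewrite lee_fin; apply: gM => //; first by rewrite ltrDl.
  by rewrite integral_cst//= /semicircle_law integral_semicircle_pdf mule1 ltry.
- exact/measurable_EFinP.
rewrite [RHS]integral_mkcond; apply: eq_integral => x _.
rewrite patchE EFinM; case: ifPn => // /negP xn.
rewrite /semicircle_pdf ifF ?mule0//; apply/negP => /andP[x1 x2]; apply: xn.
by rewrite inE/= in_itv/= !ltW.
Qed.

Lemma sin_natpi k : sin (k%:R * pi : R) = 0.
Proof.
elim: k => [|k IH]; first by rewrite mul0r sin0.
by rewrite -natr1 mulrDl mul1r sinDpi IH oppr0.
Qed.

(** Substituting x = 2 cos t turns the integrand into (2 / pi) sin((k+2)t) sin t = (cos((k+1)t) -
    cos((k+3)t)) / pi on [0, pi]; its primitive [H] vanishes at both ends. *)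
Lemma semicircle_integral_cheb k : L (horner (cheb R k.+1)) = 0.
Proof.
have pi0 : 0 < pi :> R := pi_gt0 R.
pose F (t : R) : R := 2 * cos t.
pose H (t : R) : R := pi^-1 * (k.+1%:R^-1 * sin (k.+1%:R * t) - k.+3%:R^-1 * sin (k.+3%:R * t)).
have dF (t : R) : is_derive t (1 : R) F (- (2 * sin t)).
  by rewrite /F; apply: is_derive_eq; rewrite /GRing.scale/=; ring.
have dH (t : R) : is_derive t (1 : R) H (pi^-1 * (cos (k.+1%:R * t) - cos (k.+3%:R * t))).
  have canc (c x : R) : c != 0 -> c^-1 * (x * (c * 1)) = x.
    by move=> c0; rewrite mulr1 mulrCA mulVf ?mulr1.
  by rewrite /H; apply: is_derive_eq; rewrite /GRing.scale/= !canc// pnatr_eq0.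
have F'E : derive1 F = fun t => - (2 * sin t).
  by apply/funext => t; rewrite derive1E; apply: derive_val.
have H'E : derive1 H = fun t => pi^-1 * (cos (k.+1%:R * t) - cos (k.+3%:R * t)).
  by apply/funext => t; rewrite derive1E; apply: derive_val.
have cder (G g : R -> R) : (forall t : R, is_derive t (1 : R) G (g t)) -> continuous G.
  by move=> dG t; apply/differentiable_continuous/derivable1_diffP; case: (dG t).
have cF : continuous F := cder _ _ dF.
have cH : continuous H := cder _ _ dH.
have csin2 : continuous (fun t : R => - (2 * sin t)).
  by move=> t; apply: cvgN; apply: cvgM; [exact: cvg_cst|exact: continuous_sin].
pose G x := (cheb R k.+1).[x] * semicircle_pdf x.
have cG : continuous G.
  by move=> x; apply: cvgM; [exact: continuous_horner|exact: continuous_semicircle_pdf].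
have aux (q c s : R) : q != 0 ->
    c * ((2 * q)^-1 * (2 * s)) * - - (2 * s) = 2 / q * (c * s) * s by move=> q0; field.
have aux2 (q c s c' s' : R) : q != 0 ->
    2 / q * s * s' = q^-1 * (c * c' + s * s' - (c * c' - s * s')) by move=> q0; field.
have F0 : F 0 = 2 by rewrite /F cos0 mulr1.
have Fpi : F pi = -2 by rewrite /F cospi mulrN1.
rewrite /L /Rintegral -[X in `[X, _]]Fpi -[X in `[_, X]]F0.
rewrite (@integration_by_substitution_decreasing _ F G)//; first last.
- exact: continuous_subspaceT.
- split; last 2 first.
  + by apply: cvg_at_right_filter; exact: cF.
  + by apply: cvg_at_left_filter; exact: cF.
  + by move=> t _; case: (dF t).
- rewrite F'E; apply/cvg_ex; exists (- (2 * sin pi)).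
  by apply: cvg_at_left_filter; exact: csin2.
- rewrite F'E; apply/cvg_ex; exists (- (2 * sin 0)).
  by apply: cvg_at_right_filter; exact: csin2.
- by rewrite F'E => t _; exact: csin2.
- by move=> x y xI yI xy; rewrite /F ltr_pM2l// ltr_cos.
- exact: ltW.
transitivity (fine (\int[mu]_(x in `[(0 : R)%R, (pi : R)%R])
    ((pi^-1 * (cos (k.+1%:R * x) - cos (k.+3%:R * x)))%R)%:E)).
  congr fine; apply: eq_integral => t; rewrite inE/= in_itv/= => tI; congr EFin.
  rewrite F'E /G /F !fctE/= semicircle_pdfE.
  have -> : 4 - (2 * cos t) ^+ 2 = (2 * sin t) ^+ 2.
    by rewrite !exprMn sin2cos2; ring.
  rewrite sqrtr_sqr ger0_norm; last by rewrite mulr_ge0// sin_ge0_pi.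
  have -> : (cheb R k.+1).[2 * cos t] * ((2 * pi)^-1 * (2 * sin t)) * - - (2 * sin t) =
      2 / pi * ((cheb R k.+1).[2 * cos t] * sin t) * sin t.
    by apply: aux; rewrite gt_eqF.
  rewrite cheb_sin.
  have -> : k.+1%:R * t = k.+2%:R * t - t by rewrite -[k.+2]addn1 natrD; ring.
  have -> : k.+3%:R * t = k.+2%:R * t + t by rewrite -[k.+3]addn1 natrD; ring.
  by rewrite cosB cosD; apply: aux2; rewrite gt_eqF.
rewrite (@continuous_FTC2 _ (fun x : R => pi^-1 * (cos (k.+1%:R * x) - cos (k.+3%:R * x))) H)//.
- by rewrite -EFinB /H !sin_natpi !mulr0 !sin0; rewrite /=; ring.
- apply: continuous_subspaceT => t; apply: cvgM; first exact: cvg_cst.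
  have ccos (c : R) : cos (c * x) @[x --> t] --> cos (c * t).
    apply: (@continuous_comp _ _ _ (fun x => c * x) (@cos R)); last exact: continuous_cos.
    by apply: cvgM; [exact: cvg_cst|exact: cvg_id].
  by apply: cvgB; exact: ccos.
- split; last 2 first.
  + by apply: cvg_at_right_filter; exact: cH.
  + by apply: cvg_at_left_filter; exact: cH.
  + by move=> t _; case: (dH t).
- by move=> t _; rewrite H'E.
Qed.

End semicircle_integral.

(** * Convergence in probability *)

Section whp.
Local Open Scope classical_set_scope.
Local Open Scope ring_scope.
Variables (R : realType) (I : Type) (F : set_system I).
Hypothesis FF : Filter F.
Variables (T : I -> finType) (A : forall i, {set T i}).
Local Notation "'E_ i" := (@uniform_expectation R (T i) (A i)) (at level 10, i at level 2).

(* The filter of the events of asymptotic probability 1: convergence along it is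
   convergence in probability to a constant. *)
Definition whp : set_system {i & T i} :=
  [set S | 'E_i (fun t => (~~ `[< S (existT T i t) >])%:R) @[i --> F] --> (0 : R)].

Lemma le_uniform_expectation i (f g : T i -> R) :
  (forall t, t \in A i -> f t <= g t) -> 'E_i f <= 'E_i g.
Proof. by move=> fg; rewrite ler_wpM2r ?invr_ge0// ler_sum. Qed.

Lemma uniform_expectationD i (f g : T i -> R) :
  'E_i (fun t => f t + g t) = 'E_i f + 'E_i g.
Proof. by rewrite /uniform_expectation big_split mulrDl. Qed.

Lemma uniform_expectationZ i (c : R) (f : T i -> R) : 'E_i (fun t => c * f t) = c * 'E_i f.
Proof. by rewrite /uniform_expectation -mulr_sumr mulrA. Qed.

Lemma uniform_expectation_ge0 i (f : T i -> R) :
  (forall t, t \in A i -> 0 <= f t) -> 0 <= 'E_i f.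
Proof. by move=> f0; rewrite divr_ge0// sumr_ge0. Qed.

Lemma uniform_expectation_cst i (c : R) : A i != finset.set0 -> 'E_i (fun=> c) = c.
Proof.
move=> A0; rewrite /uniform_expectation sumr_const -[c *+ _]mulr_natr mulfK//.
by rewrite pnatr_eq0 cards_eq0.
Qed.

Lemma squeeze_cvg0 (f g : I -> R) : (\forall i \near F, 0 <= f i <= g i) ->
  g i @[i --> F] --> (0 : R) -> f i @[i --> F] --> (0 : R).
Proof. by move=> fg g0; apply: (squeeze_cvgr fg) g0; exact: cvg_cst. Qed.

Lemma whp_near S : (\forall i \near F, forall t, t \in A i -> S (existT T i t)) -> whp S.
Proof.
move=> FS; apply: squeeze_cvg0 (cvg_cst (0 : R)); apply: filterS FS => i Si.
rewrite uniform_expectation_ge0//= -[leRHS](mul0r (#|A i|%:R^-1)) ler_wpM2r ?invr_ge0//.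
by rewrite big1// => t /Si St; rewrite asboolT.
Qed.

(** Stability under intersection is the union bound. Limits in probability can then be added and
    multiplied as ordinary limits. *)
#[global] Instance whp_filter : Filter whp.
Proof.
split=> [|S S' wS wS'|S S' SS' wS].
- by apply: whp_near; apply: filterE.
- apply: (@squeeze_cvg0 _ (fun i => 'E_i (fun t => (~~ `[< S (existT T i t) >])%:R) +
    'E_i (fun t => (~~ `[< S' (existT T i t) >])%:R))); last first.
    by rewrite -[0 in X in _ --> X]addr0; exact: cvgD.
  apply: filterE => i; rewrite uniform_expectation_ge0//= -uniform_expectationD.
  apply: le_uniform_expectation => t _; rewrite -natrD ler_nat.
  by rewrite /setI/= asbool_and; case: (asbool (S _)); case: (asbool (S' _)).
- apply: squeeze_cvg0 wS; apply: filterE => i; rewrite uniform_expectation_ge0//=.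
  apply: le_uniform_expectation => t _; rewrite ler_nat.
  case: asboolP => //= nS'; rewrite asboolF// => St; exact/nS'/SS'.
Qed.

Lemma whp_markov (f : forall i, T i -> R) :
  (forall i t, t \in A i -> 0 <= f i t) -> 'E_i (f i) @[i --> F] --> (0 : R) ->
  f (projT1 w) (projT2 w) @[w --> whp] --> (0 : R).
Proof.
move=> f0 Ef; apply/cvgrPdist_lt => e e0.
have Ef' : e^-1 * 'E_i (f i) @[i --> F] --> (0 : R).
  by rewrite -[0 in X in _ --> X](mulr0 e^-1); apply: cvgM; [exact: cvg_cst|].
apply: squeeze_cvg0 Ef'; apply: filterE => i; rewrite uniform_expectation_ge0//=.
rewrite -uniform_expectationZ; apply: le_uniform_expectation => t tA.
case: asboolP => //= [_|/negP]; first by rewrite mulr_ge0 ?invr_ge0 ?(ltW e0) ?f0.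
by rewrite sub0r normrN ger0_norm ?f0// -leNgt mulrC ler_pdivlMr// mul1r.
Qed.

(** The error |phi l - phi (X i t)| is below e / 2 off an event of vanishing probability, and at
    most 2M on it. Nonemptiness makes the expectation of the constant [phi l] equal to [phi l]. *)
Lemma whp_cvg_in_distribution (S : topologicalType) (X : forall i, T i -> S) (l : S) :
  (\forall i \near F, A i != finset.set0) ->
  X (projT1 w) (projT2 w) @[w --> whp] --> l -> cvg_in_distribution R F A X l.
Proof.
move=> A0 Xl phi cphi [M0 [_ phiM]]; apply/cvgrPdist_le => e e0.
pose M := `|M0| + 1; have {}phiM t : `|phi t| <= M.
  by apply: phiM => //; rewrite (le_lt_trans (ler_norm _))// ltrDl.
have M_ge0 : 0 <= M := le_trans (normr_ge0 _) (phiM l).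
have := cvg_comp _ _ Xl (cphi l); move/cvgrPdist_lt/(_ (e / 2)); rewrite divr_gt0// => /(_ isT) Pe.
have /cvgrPdist_le/(_ (e / 2)) :
    (2 * M) * 'E_i (fun t => (~~ `[< `|phi l - phi (X i t)| < e / 2 >])%:R) @[i --> F] --> (0 : R).
  by rewrite -[0 in X in _ --> X](mulr0 (2 * M)); apply: cvgM; [exact: cvg_cst|].
rewrite divr_gt0// => /(_ isT) Pi.
apply: filterS2 A0 Pi => i Ai; rewrite sub0r normrN ger0_norm; last first.
  by apply: mulr_ge0; [exact: mulr_ge0|exact: uniform_expectation_ge0].
move=> Pi; rewrite -(uniform_expectation_cst (phi l) Ai).
have -> : 'E_i (fun=> phi l) - 'E_i (fun t => phi (X i t)) = 'E_i (fun t => phi l - phi (X i t)).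
  under [in RHS]eq_fun do rewrite -mulN1r.
  by rewrite uniform_expectationD uniform_expectationZ mulN1r.
have leE f : `|'E_i f| <= 'E_i (fun t => `|f t|).
  rewrite /uniform_expectation normrM [X in _ * X]ger0_norm ?invr_ge0// ler_wpM2r ?invr_ge0//.
  exact: ler_norm_sum.
rewrite (le_trans (leE _))//.
rewrite (@le_trans _ _ ('E_i (fun t =>
  e / 2 + 2 * M * (~~ `[< `|phi l - phi (X i t)| < e / 2 >])%:R)))//.
  apply: le_uniform_expectation => t _; case: asboolP => [/ltW|_]; first by rewrite mulr0 addr0.
  rewrite mulr1 (le_trans (ler_normB _ _))// ler_wpDl ?divr_ge0 ?(ltW e0)//.
  by rewrite mulr_natl mulr2n lerD.
by rewrite uniform_expectationD uniform_expectation_cst// uniform_expectationZ [leRHS]splitr lerD2l.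
Qed.

End whp.

(** * From Chebyshev averages to weak convergence *)

Section averages.
Local Open Scope classical_set_scope.
Local Open Scope ring_scope.
Variable R : realType.
Implicit Types (f g : R -> R) (s : seq R) (p : {poly R}).
Local Notation L := (@semicircle_integral R).

Definition average f s : R := (\sum_(x <- s) f x) / (size s)%:R.

Lemma averageD f g s : average (fun x => f x + g x) s = average f s + average g s.
Proof. by rewrite /average big_split mulrDl. Qed.

Lemma averageZ c f s : average (fun x => c * f x) s = c * average f s.
Proof. by rewrite /average -mulr_sumr mulrA. Qed.

Lemma average_cst c s : (0 < size s)%N -> average (fun=> c) s = c.
Proof.
move=> s0; rewrite /average big_const_seq count_predT iter_addr_0 -[c *+ _]mulr_natr mulfK//.
by rewrite pnatr_eq0 -lt0n.
Qed.

Lemma le_average f g s : (forall x, f x <= g x) -> average f s <= average g s.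
Proof. by move=> fg; rewrite ler_wpM2r ?invr_ge0// ler_sum. Qed.

Lemma ler_norm_average f s : `|average f s| <= average (fun x => `|f x|) s.
Proof.
rewrite /average normrM [X in _ * X]ger0_norm ?invr_ge0// ler_wpM2r ?invr_ge0//.
exact: ler_norm_sum.
Qed.

Lemma ge0_integral_esd n (A : 'M[R]_n) (h : R -> \bar R) : (0 < n)%N ->
  measurable_fun setT h -> (forall x, 0 <= h x)%E ->
  (\int[(esd A : probability (measurableTypeR R) R)]_x h x =
   n%:R^-1%:E * \sum_(i < n) h (tnth (eigenvalues A) i))%E.
Proof.
move=> n0 mh h0.
have n0' : 0 <= n%:R^-1 :> R by rewrite invr_ge0.
pose m := mscale (NngNum n0') (msum (fun i => \d_((eigenvalues A)`_i : measurableTypeR R)) n).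
rewrite (@eq_measure_integral _ _ _ _ m); last first.
  move=> B _ _; apply: etrans (esdE A B n0) _; rewrite /m /mscale/= /msum; congr (_ * _)%E.
  by apply: eq_bigr => i _; rewrite (tnth_nth 0).
rewrite ge0_integral_mscale//=; congr (_ * _)%E.
rewrite ge0_integral_measure_sum//; apply: eq_bigr => i _.
by rewrite integral_dirac// diracT mul1e (tnth_nth 0).
Qed.

Lemma integral_of_esd n (A : 'M[R]_n) (f : bounded_continuous R) : (0 < n)%N ->
  integral_of f (esd A) = average (sval f) (eigenvalues A).
Proof.
move=> n0; have [cf _] := svalP f; rewrite /integral_of; move: (sval f) cf => g cg.
have mg : measurable_fun setT (EFin \o g).
  by apply/measurable_EFinP; exact: continuous_measurable_fun.
rewrite /Rintegral integralE !ge0_integral_esd//; last 2 first.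
- exact/measurable_funeneg.
- exact/measurable_funepos.
have pE x : (EFin \o g)^\+%E x = (Num.max (g x) 0)%:E by rewrite funeposE/= EFin_max.
have nE x : (EFin \o g)^\-%E x = (Num.max (- g x) 0)%:E by rewrite funenegE/= EFin_max.
under eq_bigr do rewrite pE.
under [X in (_ - _ * X)%E]eq_bigr do rewrite nE.
rewrite !sumEFin -!EFinM -EFinB/= /average -mulrBr mulrC size_tuple -sumrB big_tuple.
congr (_ * _); apply: eq_bigr => i _.
by rewrite /Num.max; case: ltP => a; case: ltP => b; lra.
Qed.

(** [C] does not depend on [K], so that [K] can be chosen after [p] and [C]. The even exponent makes
    the bound itself a nonnegative polynomial, whose average is under control. *)
Lemma poly_tail p : exists C m, [/\ 0 <= C & forall K x, (m <= K)%N -> 3 < `|x| ->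
  `|p.[x]| <= C * (x / 3) ^+ K.*2].
Proof.
elim/poly_ind: p => [|p c [C [m [C0 Cm]]]].
  by exists 0, 0%N; split=> // K x _ _; rewrite horner0 normr0 mul0r.
exists (3 * C + `|c|), m.+1; split; first by rewrite addr_ge0 ?mulr_ge0.
case=> // K x mK x3; rewrite hornerD hornerM hornerX hornerC (le_trans (ler_normD _ _))//.
have x1 : 1 <= `|x / 3|.
  by rewrite normrM [X in _ * X]ger0_norm// ler_pdivlMr// mul1r ltW.
have xE k : (x / 3) ^+ k.*2 = `|x / 3| ^+ k.*2.
  by rewrite -mul2n !exprM real_normK// num_real.
rewrite mulrDl lerD//; last by rewrite ler_peMr// xE exprn_ege1.
rewrite normrM (le_trans (ler_wpM2r (normr_ge0 _) (Cm _ _ mK x3)))//.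
have -> : `|x| = 3 * `|x / 3| by rewrite normrM [X in _ * (_ * X)]ger0_norm//; field.
rewrite !xE doubleS !exprS mulrCA -[3 * C * _]mulrA ler_wpM2l// -mulrA ler_wpM2l//.
rewrite mulrC ler_wpM2l//.
by rewrite ler_peMl// exprn_ge0.
Qed.

(** * The method of moments along an arbitrary filter *)

Section convergence.
Variables (Omega : Type) (G : set_system Omega).
Hypothesis FG : Filter G.
Variable s : Omega -> seq R.
Hypothesis s_neq0 : \forall w \near G, (0 < size (s w))%N.
Hypothesis s_cheb : forall k, average (horner (cheb R k.+1)) (s w) @[w --> G] --> (0 : R).

Lemma average_poly p : average (horner p) (s w) @[w --> G] --> L (horner p).
Proof.
elim/cheb_ind: p => [|[|k]]; last first.
- by rewrite semicircle_integral_cheb.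
- have -> : horner (cheb R 0) = fun=> 1 by apply/funext => x; rewrite hornerC.
  rewrite semicircle_integral1; apply: cvg_near_cst.
  by apply: filterS s_neq0 => w ?; rewrite average_cst.
split=> [p q Lp Lq|c p Lp].
- have -> : horner (p + q) = fun x => p.[x] + q.[x] by apply/funext => x; rewrite hornerD.
  rewrite semicircle_integralD; try exact: continuous_horner.
  by under eq_fun do rewrite averageD; exact: cvgD.
- have -> : horner (c *: p) = fun x => c * p.[x] by apply/funext => x; rewrite hornerZ.
  rewrite semicircle_integralZ; try exact: continuous_horner.
  by under eq_fun do rewrite averageZ; apply: cvgM => //; exact: cvg_cst.
Qed.

(* Weierstrass on [-3, 3]; outside, the error is at most a multiple of
   (x / 3) ^ (2K), of asymptotic average at most (4 / 9) ^ K. *)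
Lemma average_bounded f M : continuous f -> (forall x, `|f x| <= M) ->
  average f (s w) @[w --> G] --> L f.
Proof.
move=> cf fM; apply/cvgrPdist_le => e' e'0.
(* Approximating [f] by [p] costs 3e in the average (e on the segment, 2e for the tails) and e in
   the integral; the convergence for [p] costs another e. *)
pose e := e' / 5; have e0 : 0 < e by rewrite divr_gt0.
have [|p fp] := @weierstrass _ f M e (-3) 3 _ cf fM e0; first by lra.
have cp : continuous (horner p) := @continuous_horner _ p.
have [C [m [C0 Cm]]] := poly_tail p.
have M0 : 0 <= M := le_trans (normr_ge0 _) (fM 0).
have [K mK CK] : exists2 K, (m <= K)%N & (M + C) * (4 / 9) ^+ K <= e.
  have : (M + C) * (4 / 9) ^+ K @[K --> \oo] --> (M + C) * 0.
    apply: cvgM; first exact: cvg_cst.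
    by apply: cvg_expr; rewrite ger0_norm; lra.
  rewrite mulr0 => /cvgrPdist_le/(_ _ e0) HK.
  have [K [mK]] := filter_ex (filterI (nbhs_infty_ge m) HK).
  rewrite sub0r normrN => /(le_trans (ler_norm _)); by exists K.
pose q : {poly R} := 'X^(K.*2).
have fpq x : `|f x - p.[x]| <= e + (M + C) / 9 ^+ K * q.[x].
  have q0 : 0 <= q.[x] by rewrite hornerXn -mul2n exprM exprn_ge0// sqr_ge0.
  have D0 : 0 <= (M + C) / 9 ^+ K by rewrite divr_ge0 ?addr_ge0// exprn_ge0.
  have [x3|x3] := leP `|x| 3.
    have xI : -3 <= x <= 3 by rewrite -ler_norml.
    by rewrite (le_trans (fp _ xI))// lerDl mulr_ge0.
  have x1 : 1 <= (x / 3) ^+ K.*2.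
    rewrite -mul2n exprM exprn_ege1//; rewrite -real_normK ?num_real// exprn_ege1//.
    by rewrite normrM [X in _ * X]ger0_norm// ler_pdivlMr// mul1r ltW.
  rewrite (le_trans (ler_normB _ _))// (le_trans (lerD (fM x) (Cm _ _ mK x3)))//.
  rewrite (@le_trans _ _ ((M + C) * (x / 3) ^+ K.*2))//; first by rewrite mulrDl lerD2r ler_peMr.
  rewrite ler_wpDl ?(ltW e0)// -mulrA ler_wpM2l ?addr_ge0//.
  rewrite hornerXn expr_div_n -mul2n [3 ^+ _]exprM mulrC.
  by have -> : 3 ^+ 2 = 9 :> R by rewrite -natrX.
have Lq : L (horner q) <= 4 ^+ K.
  rewrite (le_trans (ler_norm _))//; apply: semicircle_integral_le; first exact: continuous_horner.
  move=> x; rewrite -ler_norml => x2; rewrite hornerXn normrX -mul2n exprM lerXn2r// ?nnegrE//.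
  by have := normr_ge0 x; nra.
have cL : `|L f - L (horner p)| <= e.
  have -> : L f - L (horner p) = L (fun x => f x - p.[x]).
    have -> : (fun x => f x - p.[x]) = fun x => f x + -1 * p.[x].
      by apply/funext => x; rewrite mulN1r.
    rewrite semicircle_integralD ?semicircle_integralZ ?mulN1r//.
    by move=> x; apply: cvgM; [exact: cvg_cst|exact: cp].
  apply: semicircle_integral_le; first by move=> x; apply: cvgB; [exact: cf|exact: cp].
  by move=> x /andP[x1 x2]; apply: fp; apply/andP; split; lra.
have ap := @average_poly p; move/cvgrPdist_le : ap => /(_ _ e0) ap.
have : (M + C) / 9 ^+ K * average (horner q) (s w) @[w --> G] --> (M + C) / 9 ^+ K * L (horner q).
  by apply: cvgM; [exact: cvg_cst|exact: average_poly].
move/cvgrPdist_le => /(_ _ e0) aq.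
have qe : (M + C) / 9 ^+ K * L (horner q) <= e.
  apply: le_trans CK; rewrite expr_div_n mulrAC -mulrA ler_wpM2l ?addr_ge0//.
  by rewrite ler_wpM2r ?invr_ge0 ?exprn_ge0.
apply: filterS3 s_neq0 ap aq => w sw ap aq.
have af : `|average f (s w) - average (horner p) (s w)| <=
    e + (M + C) / 9 ^+ K * average (horner q) (s w).
  have -> : average f (s w) - average (horner p) (s w) = average (fun x => f x - p.[x]) (s w).
    have -> : (fun x => f x - p.[x]) = fun x => f x + -1 * p.[x].
      by apply/funext => x; rewrite mulN1r.
    by rewrite averageD averageZ mulN1r.
  rewrite (le_trans (ler_norm_average _ _))// (le_trans (le_average _ fpq))//.
  by rewrite averageD average_cst// averageZ.
move: qe aq af ap cL; set u := _ * average (horner q) _; set v := _ * L (horner q).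
have -> : e' = 5 * e by rewrite /e; field.
rewrite !ler_norml => qe /andP[aq1 aq2] /andP[af1 af2] /andP[ap1 ap2] /andP[cL1 cL2].
by apply/andP; split; lra.
Qed.

End convergence.
End averages.

(** * Spectra of random regular graphs *)

Section regular_spectrum.
Local Open Scope classical_set_scope.
Local Open Scope ring_scope.
Variable R : realType.

Definition rescaled_eigenvalues n d (E : {set {set 'I_n}}) : seq R :=
  eigenvalues ((Num.sqrt (d%:R - 1))^-1 *: adjacency R E).

Definition closed_nbwalks n d k (E : {set {set 'I_n}}) : R :=
  (\sum_b nbwalks (adj E) k b b)%:R / Num.sqrt (d%:R - 1) ^+ k / n%:R.

Lemma average_cheb n d k (E : {set {set 'I_n}}) :
  (0 < n)%N -> (1 < d)%N -> E \in regular_graphs n d ->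
  average (horner (cheb R k.+1)) (rescaled_eigenvalues d E) =
  closed_nbwalks d k.+1 E +
  (if k is k'.+1 then
     (d%:R - 1)^-1 * average (horner (cheb R k')) (rescaled_eigenvalues d E)
   else 0).
Proof.
case: n E => // n E _ d1 EP; rewrite /closed_nbwalks /average.
rewrite [size _]size_tuple; case: k => [|k].
  by rewrite addr0 expr1 trace_nbwalks1.
by rewrite (trace_nbwalks R EP d1) mulrA -mulrDl subrK.
Qed.

Lemma closed_nbwalks_ge0 n d k (E : {set {set 'I_n}}) : 0 <= closed_nbwalks d k E.
Proof. by rewrite !divr_ge0// exprn_ge0// sqrtr_ge0. Qed.

(** The factor (d - 1)^(-(k+1)/2) is merely bounded by 1. Since d <= 2 (d - 1), the product d^(k+1)
    (d - 1) is at most 2^(k+1) (d - 1)^(2k+2), hence at most 2^(k+1) n by the last assumption. *)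
Lemma mean_closed_nbwalks n d k : (1 < d)%N -> (d < n)%N ->
  ((d.*2 + k.+2).*2 <= n)%N -> (d.-1 ^ k.+1.*2 <= n)%N ->
  uniform_expectation (regular_graphs n d) (@closed_nbwalks n d k.+1) <=
  (k.+1 ^ 2 * 2 * 2 ^ k.+1)%:R / (d%:R - 1).
Proof.
move=> d1 dn kn dkn; set N := #|regular_graphs n d|.
have a1 : 1 <= d%:R - 1 :> R by rewrite lerBrDr -mulr2n ler_nat.
have s1 : 1 <= Num.sqrt (d%:R - 1) ^+ k.+1 :> R.
  by apply: exprn_ege1; rewrite -{1}sqrtr1 ler_wsqrtr.
have n0 : 0 < n%:R :> R by rewrite ltr0n; lia.
apply: (@le_trans _ _ ((k.+1 ^ 2 * (2 * d ^ k.+1))%:R / n%:R)).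
  rewrite /uniform_expectation /closed_nbwalks -!mulr_suml -natr_sum.
  have [N0|N0] := posnP N; first by rewrite -/N N0 invr0 mulr0 divr_ge0.
  rewrite [leLHS]mulrAC ler_pM2r ?invr_gt0// ler_pdivrMr ?ltr0n//.
  rewrite ler_pdivrMr ?(lt_le_trans ltr01)//.
  apply: (@le_trans _ _ (k.+1 ^ 2 * (2 * d ^ k.+1) * N)%:R).
    by rewrite ler_nat -mulnA sum_trace_nbwalks// ltnW.
  by rewrite natrM ler_peMr.
rewrite ler_pdivrMr// mulrAC ler_pdivlMr ?(lt_le_trans ltr01)//.
have -> : d%:R - 1 = (d.-1)%:R :> R by rewrite -subn1 natrB// ltnW.
rewrite -!natrM ler_nat.
apply: (@leq_trans (k.+1 ^ 2 * 2 * 2 ^ k.+1 * d.-1 ^ k.+1.*2)); last by rewrite leq_mul2l dkn orbT.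
have -> : (k.+1 ^ 2 * (2 * d ^ k.+1) * d.-1 = k.+1 ^ 2 * 2 * (d ^ k.+1 * d.-1))%N by ring.
rewrite -[leqRHS]mulnA leq_mul2l; apply/orP; right.
rewrite -addnn expnD mulnA -expnMn leq_mul//.
  by rewrite leq_exp2r//; lia.
by rewrite expnS leq_pmulr// expn_gt0; lia.
Qed.

Section asymptotics.
Variables (d : nat -> nat) (eps : nat -> R).
Hypothesis d_infty : d @ \oo --> \oo.
Hypothesis eps_to0 : eps @ \oo --> (0 : R).
Hypothesis d_eps : \forall n \near \oo, (d n)%:R - 1 = n%:R `^ eps n.

(** (d - 1)^k = n^(k eps) is at most n once k eps <= 1. *)
Lemma degree_pow_le k : \forall n \near \oo, ((d n).-1 ^ k <= n)%N.
Proof.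
have /cvgrPdist_le/(_ 1 ltr01) : eps n * k%:R @[n --> \oo] --> (0 : R).
  by rewrite -[0 in X in _ --> X](mul0r k%:R); apply: cvgM => //; exact: cvg_cst.
have d0 : \forall n \near \oo, (0 < d n)%N by exact: d_infty (nbhs_infty_gt _).
move=> ek; apply: filterS3 (filterI d0 (nbhs_infty_gt 0)) ek d_eps => n [dn n0] ekn den.
have n1 : 1 <= n%:R :> R by rewrite ler1n.
rewrite -(ler_nat R) natrX -subn1 natrB// den.
rewrite -powR_mulrn ?powR_ge0// -powRrM -[leRHS]powRr1 ?(le_trans ler01)//.
apply: ler_powR => //; apply: le_trans (ler_norm _) _.
by move: ekn; rewrite sub0r normrN.
Qed.

Lemma inv_degree_cvg0 : ((d n)%:R - 1)^-1 @[n --> \oo] --> (0 : R).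
Proof.
apply/cvgrPdist_le => e e0.
have dn : \forall n \near \oo, ((Num.truncn e^-1).+1 < d n)%N.
  exact: d_infty (nbhs_infty_gt _).
apply: filterS dn => n dn; rewrite sub0r normrN.
have ed : e^-1 <= (d n)%:R - 1.
  rewrite lerBrDr (@le_trans _ _ (Num.truncn e^-1).+2%:R)//; last by rewrite ler_nat.
  by rewrite -[_.+2]addn1 natrD lerD2r ltW// truncnS_gt// invr_ge0 ltW.
have e1 : 0 < e^-1 by rewrite invr_gt0.
rewrite ger0_norm ?invr_ge0 ?(le_trans (ltW e1))//.
by rewrite -[leRHS]invrK lef_pV2 ?posrE// (lt_le_trans e1).
Qed.

Definition admissible : set nat := [set n : nat | (d n < n)%N /\ ~~ odd (n * d n)].

Local Notation F := (within admissible \oo).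
Local Notation whpG := (@whp R _ F (fun n => {set {set 'I_n}}) (fun n => regular_graphs n (d n))).

Lemma eventually_admissible k : \forall n \near F, [/\ (1 < d n)%N, (d n < n)%N,
  (((d n).*2 + k.+2).*2 <= n)%N & ((d n).-1 ^ k.+1.*2 <= n)%N].
Proof.
(* This lower bound gives 4d + 2k + 4 <= (d - 1)^2, and (d - 1)^2 <= n eventually. *)
have dk : \forall n \near \oo, (k.*2 + 10 < d n)%N by exact: d_infty (nbhs_infty_gt _).
suff : \forall n \near \oo, admissible n -> [/\ (1 < d n)%N, (d n < n)%N,
  (((d n).*2 + k.+2).*2 <= n)%N & ((d n).-1 ^ k.+1.*2 <= n)%N] by [].
apply: filterS3 dk (degree_pow_le 2) (degree_pow_le k.+1.*2) => n dk d2 dk2 [dn _].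
split=> //; first by lia.
by apply: leq_trans d2; rewrite expnS expn1; nia.
Qed.

Lemma regular_graphs_near_neq0 : \forall n \near F, regular_graphs n (d n) != finset.set0.
Proof.
apply: filterS (withinT _ _) => n [dn nd]; exact: regular_graphs_neq0.
Qed.

Lemma closed_nbwalks_cvg k :
  closed_nbwalks (d (projT1 w)) k.+1 (projT2 w) @[w --> whpG] --> (0 : R).
Proof.
apply: (whp_markov _ (f := fun n => @closed_nbwalks n (d n) k.+1)).
  by move=> n E _; exact: closed_nbwalks_ge0.
have : (k.+1 ^ 2 * 2 * 2 ^ k.+1)%:R * ((d n)%:R - 1)^-1 @[n --> F] --> (0 : R).
  rewrite -[0 in X in _ --> X](mulr0 (k.+1 ^ 2 * 2 * 2 ^ k.+1)%:R).
  apply: cvgM; first exact: cvg_cst.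
  exact: cvg_trans (cvg_app _ (cvg_within _)) inv_degree_cvg0.
apply: squeeze_cvg0; apply: filterS (eventually_admissible k) => n [d1 dn kn dkn].
rewrite mean_closed_nbwalks// andbT; apply: uniform_expectation_ge0 => E _.
exact: closed_nbwalks_ge0.
Qed.

Lemma whp_regular P : (forall n E, (0 < n)%N -> (1 < d n)%N ->
    E \in regular_graphs n (d n) -> P (existT _ n E)) -> whpG P.
Proof.
move=> PE; apply: whp_near; apply: filterS (eventually_admissible 0) => n [d1 dn _ _] E EP.
by apply: PE => //; exact: leq_ltn_trans dn.
Qed.

(** Strong induction through [average_cheb], which passes from k - 2 to k: the correction is 1 / (d
    - 1), tending to 0, times a convergent average. Including k = 0, with limit 1, starts the even
    degrees. *)
Lemma average_cheb_cvg k :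
  average (horner (cheb R k)) (rescaled_eigenvalues (d (projT1 w)) (projT2 w))
    @[w --> whpG] --> ((k == 0%N)%:R : R).
Proof.
elim/ltn_ind: k => -[|k] IH.
  apply: cvg_near_cst; apply: whp_regular => n E n0 _ _ /=.
  have -> : horner (cheb R 0) = fun=> 1 by apply/funext => x; rewrite hornerC.
  by rewrite average_cst// size_tuple.
apply: (@cvg_trans _ ((closed_nbwalks (d (projT1 w)) k.+1 (projT2 w) +
  (if k is k'.+1 then ((d (projT1 w))%:R - 1)^-1 *
     average (horner (cheb R k')) (rescaled_eigenvalues (d (projT1 w)) (projT2 w))
   else 0)) @[w --> whpG])).
  apply: near_eq_cvg; apply: whp_regular => n E n0 d1 EP /=.
  by rewrite average_cheb.
have -> : ((k.+1 == 0%N)%:R : R) = 0 + 0 by rewrite addr0.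
apply: cvgD; first exact: closed_nbwalks_cvg.
case: k IH => [|k] IH; first exact: cvg_cst.
have -> : (0 : R) = 0 * (k == 0%N)%:R by rewrite mul0r.
apply: cvgM; last exact: IH.
(* The degree depends on [n] only, so its deterministic limit is also a limit along [whp]. *)
move=> U U0; apply: whp_near.
have : \forall n \near F, U ((d n)%:R - 1)^-1.
  exact: cvg_trans (cvg_app _ (cvg_within _)) inv_degree_cvg0 _ U0.
by apply: filterS => n Un E _.
Qed.

End asymptotics.
End regular_spectrum.

Unset Implicit Arguments.
Local Open Scope classical_set_scope.
Local Open Scope ring_scope.

Theorem theorem1 (R : realType) (d : nat -> nat) (eps : nat -> R)
    (d_pos : forall n, (0 < d n)%N)
    (d_infty : d @ \oo --> \oo)
    (eps_to0 : eps @ \oo --> (0 : R))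
    (d_eps : \forall n \near \oo, (d n)%:R - 1 = n%:R `^ eps n) :
  cvg_in_distribution R
    (within [set n : nat | (d n < n)%N /\ ~~ odd (n * d n)] \oo)
    (fun n => regular_graphs n (d n))
    (fun n E => esd ((Num.sqrt ((d n)%:R - 1))^-1 *: adjacency R E))
    (semicircle_law : borel_probability R).
Proof.
apply: whp_cvg_in_distribution; first exact: regular_graphs_near_neq0.
(* Weak convergence in probability is tested on one bounded continuous [f] at a time. *)
apply/cvg_weakP => f; rewrite integral_of_semicircle.
have [cf [M [_ fM]]] := svalP f.
have {}fM x : `|sval f x| <= `|M| + 1.
  by apply: fM => //; rewrite (le_lt_trans (ler_norm _))// ltrDl.
pose s (w : {n & {set {set 'I_n}}}) := rescaled_eigenvalues R (d (projT1 w)) (projT2 w).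
apply: (@cvg_trans _ (average (sval f) (s w) @[w --> whp R
    (within (admissible d) \oo) (fun n => regular_graphs n (d n))])).
  apply: (@near_eq_cvg _ _ _ _ _ (fun w : {n & {set {set 'I_n}}} => integral_of f
    (esd ((Num.sqrt ((d (projT1 w))%:R - 1))^-1 *: adjacency R (projT2 w))))).
    exact: whp_filter.
  apply: (whp_regular d_infty eps_to0 d_eps) => n E n0 _ _ /=.
  by rewrite integral_of_esd.
apply: average_bounded cf fM.
  apply: (whp_regular d_infty eps_to0 d_eps) => n E n0 _ _ /=.
  by rewrite size_tuple.
by move=> k; exact: (average_cheb_cvg d_infty eps_to0 d_eps (k := k.+1)).
Qed.
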